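(* Let $G$ be a group and $X$ a generating set of $G$. Suppose that the Cayley graph $\Gamma(G,X)$ is hyperbolic and that $G$ acts acylindrically on $\Gamma(G,X)$. Then there exists a constant $C>0$ such that the following holds. Let $a,b\in G$ be two loxodromic elements (with respect to $X$) which are shortest in their conjugacy classes (with respect to $|\cdot|_X$) and such that $|a|_X\geqslant |b|_X$. Let $x,y\in G$ be arbitrary elements and $r$ an arbitrary non-negative integer. Set $$f(r)=\frac{2r}{\mathbf{inj}(G,X)}+C.$$ If a subpath $p\subset L(x,a)$ contains at least $f(r)$ $a$-periods and lies in the $r$-neighborhood of $L(y,b)$, then there exist integers $s,t\neq 0$ such that $$(x^{-1}y)\,b^s\,(y^{-1}x)=a^t.$$ In particular, $a$ and $b$ are commensurable.
   Context: Generating sets are assumed symmetric (closed under inverses) and may be infinite. For $g\in G$, $|g|_X$ is the length of a shortest word in $X$ representing $g$, and $d_X(g,h)=|g^{-1}h|_X$. $\Gamma(G,X)$ is the right Cayley graph (vertices $g\in G$, edges from $g$ to $gx$ labelled $x\in X$) with the usual path metric, each edge having length 1; $G$ acts on it by left multiplication. Paths are combinatorial edge paths. A geodesic metric space is $\delta$-hyperbolic if each side of every geodesic triangle lies in the $\delta$-neighborhood of the union of the other two sides; it is hyperbolic if it is $\delta$-hyperbolic for some $\delta\geqslant 0$. The action of $G$ on $\Gamma(G,X)$ is acylindrical if for every $\varepsilon\geqslant 0$ there exist $R,N>0$ such that for any $g\in G$ with $|g|_X\geqslant R$ we have $|\{f\in G : |f|_X\leqslant\varepsilon,\ |g^{-1}fg|_X\leqslant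 \varepsilon\}|\leqslant N$. An element $g\in G$ is loxodromic with respect to $X$ if there exist $\eta>0$ and $\nu\geqslant 0$ such that $|g^n|_X\geqslant \eta n-\nu$ for all $n\in\mathbb{N}$. The stable norm of $g$ is $\|g\|_X=\lim_{n\to\infty}|g^n|_X/n$. The injectivity radius $\mathbf{inj}(G,X)$ is the infimum of the stable norms $\|g\|_X$ over all loxodromic elements $g\in G$; by a theorem of Bowditch, under the hypotheses on $G$ and $X$ above this is a positive number. For $x,a\in G$, $L(x,a)$ denotes a bi-infinite path in $\Gamma(G,X)$ obtained by connecting the consecutive points $\dots,xa^{-1},x,xa,\dots$ by geodesic segments so that, for all $n\in\mathbb{Z}$, the segment $p_n$ connecting $xa^n$ to $xa^{n+1}$ has the same label as the segment $p_0$ connecting $x$ to $xa$. The paths $p_n$ are called $a$-periods of $L(x,a)$. A subpath $p\subset L(x,a)$ contains $k$ $a$-periods ($k\in\mathbb{N}$) if there exists $n\in\mathbb{Z}$ such that $p_np_{n+1}\cdots p_{n+k-1}$ is a subpath of $p$. Two elements $a,b\in G$ of infinite order are commensurable if there exist $g\in G$ and $s,t\in\mathbb{Z}\setminus\{0\}$ such that $a^s=g^{-1}b^tg$. *)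

(* Defs.v *)
From HB Require Import structures.
From mathcomp Require Import all_boot all_order all_algebra.
From mathcomp Require Import all_classical all_reals all_analysis.

Set Implicit Arguments.
Unset Strict Implicit.
Unset Printing Implicit Defensive.

Import Order.TTheory GRing.Theory Num.Theory.
Import numFieldNormedType.Exports.
Local Open Scope classical_set_scope.
Local Open Scope ring_scope.

Definition zexpg (G : groupType) (g : G) (n : int) : G :=
  match n with
  | Posz k => (g ^+ k)%g
  | Negz k => (g ^- k.+1)%g
  end.

Definition infinite_order (G : groupType) (g : G) : Prop :=
  forall n : nat, (0 < n)%N -> (g ^+ n)%g <> 1%g.

Definition commensurable (G : groupType) (a b : G) : Prop :=
  [/\ infinite_order a, infinite_order b &
      exists (g : G) (s t : int),
        [/\ s <> 0, t <> 0 & zexpg a s = (g^-1 * zexpg b t * g)%g]].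

Section Words.
Variables (G : groupType) (X : set G).

Definition symmetric_set : Prop := forall x, X x -> X (x^-1)%g.

Definition word_value (w : seq G) : G := (\prod_(z <- w) z)%g.

Definition spells (w : seq G) (g : G) : Prop :=
  (forall z, z \in w -> X z) /\ word_value w = g.

(* For a symmetric X this says that X generates G as a group. *)
Definition generates : Prop := forall g, exists w, spells w g.

(* |g|_X (0 by default if no word in X represents g) *)
Definition word_length (g : G) : nat :=
  xget 0%N [set n | (exists2 w, spells w g & size w = n) /\
                    (forall w, spells w g -> (n <= size w)%N)].

Definition word_dist (g h : G) : nat := word_length (g^-1 * h)%g.

Definition geodesic_word (w : seq G) (g : G) : Prop :=
  spells w g /\ size w = word_length g.

Definition shortest_in_conj_class (g : G) : Prop :=
  forall h : G, (word_length g <= word_length (g ^ h)%g)%N.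

End Words.

Section PseudoMetric.
Variables (R : realType) (T : Type).
(* A (pseudo)metric space is given by a carrier D and a distance d. *)
Variables (D : set T) (d : T -> T -> R).

(* c, restricted to [0, l], is a geodesic of D from p to q. *)
Definition geodesic_from_to (c : R -> T) (l : R) (p q : T) : Prop :=
  [/\ 0 <= l,
      (forall s, 0 <= s <= l -> D (c s)),
      (forall s t, 0 <= s <= l -> 0 <= t <= l -> d (c s) (c t) = `|s - t|),
      d (c 0) p = 0 &
      d (c l) q = 0].

(* It is enough to consider the first side, since the triangle is arbitrary
   (p, q, r may be permuted cyclically). *)
Definition delta_hyperbolic (delta : R) : Prop :=
  forall (p q r : T) (c1 c2 c3 : R -> T) (l1 l2 l3 : R),
    D p -> D q -> D r ->
    geodesic_from_to c1 l1 p q ->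
    geodesic_from_to c2 l2 q r ->
    geodesic_from_to c3 l3 r p ->
    forall s, 0 <= s <= l1 ->
      (exists2 t, 0 <= t <= l2 & d (c1 s) (c2 t) <= delta) \/
      (exists2 t, 0 <= t <= l3 & d (c1 s) (c3 t) <= delta).

Definition hyperbolic : Prop := exists2 delta, 0 <= delta & delta_hyperbolic delta.

End PseudoMetric.

Section CayleyGraph.
Variables (R : realType) (G : groupType) (X : set G).

(* (g, x, t) with x in X and 0 <= t <= 1 is the point at distance t from g
   along the edge from g to g x labelled x; (g, 1, 0) is the vertex g, whether
   or not 1 is in X. *)
Definition cayley_point : Type := G * G * R.

Definition vertex (g : G) : cayley_point := (g, 1%g, 0).

Definition cayley_graph : set cayley_point :=
  [set p | (X p.1.2 /\ 0 <= p.2 <= 1) \/ (p.1.2 = 1%g /\ p.2 = 0)].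

(* Length of a shortest route from p to q through an endpoint of the edge of p
   and an endpoint of the edge of q. *)
Definition dist_via_vertices (p q : cayley_point) : R :=
  let: (g, x, s) := p in let: (h, y, t) := q in
  Num.min
    (Num.min (s + (word_dist X g h)%:R + t)
             (s + (word_dist X g (h * y)%g)%:R + (1 - t)))
    (Num.min ((1 - s) + (word_dist X (g * x)%g h)%:R + t)
             ((1 - s) + (word_dist X (g * x)%g (h * y)%g)%:R + (1 - t))).

(* The path metric. An edge (g, x) and its inverse (g x, x^-1) are the same
   1-cell with opposite parametrizations. This leaves out x = 1: a loop has
   length 1 and is not folded onto itself. As several triples may stand for the
   same point, cayley_dist is a pseudometric on triples; the Cayley graph is the
   quotient metric space. *)
Definition cayley_dist (p q : cayley_point) : R :=
  let: (g, x, s) := p in let: (h, y, t) := q in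
  if (h == g) && (y == x) then Num.min `|s - t| (dist_via_vertices p q)
  else if [&& x != 1%g, h == (g * x)%g & y == (x^-1)%g]
  then Num.min `|s - (1 - t)| (dist_via_vertices p q)
  else dist_via_vertices p q.

Definition cayley_hyperbolic : Prop := hyperbolic cayley_graph cayley_dist.

Definition acylindrical : Prop :=
  forall eps : R, 0 <= eps ->
  exists (r : R) (N : nat), [/\ 0 < r, (0 < N)%N &
    forall g : G, r <= (word_length X g)%:R ->
      ([set f : G | (word_length X f)%:R <= eps /\
                    (word_length X (g^-1 * f * g)%g)%:R <= eps] #<= `I_N)%card].

Definition loxodromic (g : G) : Prop :=
  exists eta nu : R, [/\ 0 < eta, 0 <= nu &
    forall n : nat, eta * n%:R - nu <= (word_length X (g ^+ n)%g)%:R].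

Definition stable_norm (g : G) : R :=
  limn (fun n : nat => (word_length X (g ^+ n)%g)%:R / n%:R : R).

Definition injectivity_radius : R :=
  inf [set stable_norm g | g in [set g | loxodromic g]].

End CayleyGraph.

(* A finite edge path is given by its initial vertex and its label. *)
Section Paths.
Variable G : groupType.

Definition edge_path : Type := G * seq G.

Definition subpath (p q : edge_path) : Prop :=
  exists w1 w2 : seq G,
    q.2 = w1 ++ p.2 ++ w2 /\ p.1 = (q.1 * word_value w1)%g.

(* The points of the Cayley graph lying on p. *)
Definition path_points (R : realType) (p : edge_path) : set (cayley_point R G) :=
  [set z | z = vertex R p.1 \/
     exists (w1 w2 : seq G) (x : G) (t : R),
       [/\ p.2 = w1 ++ x :: w2, 0 <= t <= 1 &
           z = ((p.1 * word_value w1)%g, x, t)]].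
Arguments path_points : clear implicits.

(* The bi-infinite path L(x, a) is determined by x, a and the label u of its
   a-periods, a geodesic word representing a: p_n starts at x a^n and has
   label u. periods x a u n k is the path p_n p_{n+1} ... p_{n+k-1}. *)
Definition periods (x a : G) (u : seq G) (n : int) (k : nat) : edge_path :=
  ((x * zexpg a n)%g, flatten (nseq k u)).

Definition subpath_of_line (p : edge_path) (x a : G) (u : seq G) : Prop :=
  exists (n : int) (k : nat), subpath p (periods x a u n k).

Definition line_points (R : realType) (x a : G) (u : seq G) :
    set (cayley_point R G) :=
  [set z | exists n : int, path_points R (periods x a u n 1) z].

Definition contains_periods (p : edge_path) (x a : G) (u : seq G) (k : nat) :
    Prop :=
  exists n : int, subpath (periods x a u n k) p.

End Paths.

Arguments path_points {G} R p _.
Arguments line_points {G} R x a u _.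

Definition in_neighborhood (R : realType) (G : groupType) (X : set G) (r : R)
    (A B : set (cayley_point R G)) : Prop :=
  forall z, A z -> exists2 z', B z' & cayley_dist X z z' <= r.

(* Main.v *)
Require Import Defs.
From HB Require Import structures.
From mathcomp Require Import all_boot all_order all_algebra.
From mathcomp Require Import all_classical all_reals all_analysis.
From mathcomp Require Import zify lra ring.

Set Implicit Arguments.
Unset Strict Implicit.
Unset Printing Implicit Defensive.

Import Order.TTheory GRing.Theory Num.Theory.
Import numFieldNormedType.Exports.
Local Open Scope classical_set_scope.
Local Open Scope ring_scope.

(** Everything is reduced to one inequality between natural numbers, the
four-point condition (four_point): among three sums of opposite distances of
four group elements, the two largest differ by at most D.  It follows from
slim triangles (hyperbolic_four_point), and afterwards geodesics are hardly used:
powers of elements and the distances between them do the work.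

Write |g| for the word length and sn g for the stable norm.  Always
n sn g <= |g^n|.  The uniformity of the constant rests on the converse: there
is one K with |a^n| <= n sn a + K for every loxodromic a that is shortest in
its conjugacy class (shortest_linear_upper), so that the orbit of <a> is a
quasi-line with uniform constants.  For long a this holds because minimality
forbids backtracking at a (shortest_in_conj_class_square), and the four-point
condition propagates the absence of backtracking to all powers
(expg_superadditive).  For short a, some power with bounded exponent does not
backtrack, provided that the stable norms of loxodromic elements are bounded
away from 0 (stable_norm_bounded_below, a theorem of Bowditch): if sn g were
tiny, a suitable conjugate h of g would have N + 1 distinct powers moving both
1 and some far h^n by a bounded amount, against acylindricity.

Now let the r-neighborhood of L(y, b) contain a long stretch of L(x, a).  Cut
off the powers a^i of length at most r plus a constant from both ends, which
costs at most 2 r / inj(G, X) plus a constant number of periods.  The rest lies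
within uniform distance of L(y, b) (middle_between).  There A = x a x^-1 and
B = y b y^-1 both act almost as translations of one line, so they almost
commute: all the elements B A^j B^-1 A^-j move the points of the middle part by a
uniformly bounded amount (translates_almost_commute).  Two points of the
middle part that are separated by a uniformly bounded number of periods are far
enough apart for acylindricity, so B A^j B^-1 A^-j = B A^j' B^-1 A^-j' for some
j <> j', and a power of A commutes with B (overlap_commute).  The number
of periods that this takes is uniform because |b| <= |a|: a translation by B
crosses only a bounded number of periods of a.

Finally, an element h commuting with a loxodromic c keeps the line of <c> at
bounded distance from itself, hence its powers stay at a distance from <c>
that is bounded independently of the exponent (centralizer_close).
Acylindricity gives a coincidence once more, and it reads
h^j = c^i with j <> 0 (commuting_common_power). *)

(** * Word lengths *)

Section WordLength.
Variables (G : groupType) (X : set G).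
Hypotheses (X_sym : symmetric_set X) (X_gen : generates X).
Implicit Types (g h : G) (w : seq G).

Local Notation len := (word_length X).
Local Notation d := (word_dist X).

Lemma word_value_cat w1 w2 :
  word_value (w1 ++ w2) = (word_value w1 * word_value w2)%g.
Proof. by rewrite /word_value big_cat. Qed.

Lemma word_value_cons x w : word_value (x :: w) = (x * word_value w)%g.
Proof. by rewrite /word_value big_cons. Qed.

Lemma word_value_nil : word_value [::] = 1%g :> G.
Proof. by rewrite /word_value big_nil. Qed.

Lemma spells_cat w1 w2 g h :
  spells X w1 g -> spells X w2 h -> spells X (w1 ++ w2) (g * h)%g.
Proof.
move=> [X1 <-] [X2 <-]; split; last by rewrite word_value_cat.
by move=> z; rewrite mem_cat => /orP[/X1|/X2].
Qed.

Lemma spells_inv w g :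
  spells X w g -> spells X (rev (map (fun x => x^-1)%g w)) (g^-1)%g.
Proof.
move=> [Xw <-]; split.
  by move=> z; rewrite mem_rev => /mapP[x /Xw xX ->]; exact: X_sym.
elim: w {Xw} => [|x w IH]; first by rewrite word_value_nil invg1.
rewrite map_cons rev_cons -cats1 word_value_cat IH.
by rewrite !word_value_cons word_value_nil mulg1 invgM.
Qed.

(** The default value in the definition of the word length is never taken, because
the generating set generates. *)
Lemma word_length_prop g :
  (exists2 w, spells X w g & size w = len g) /\
  (forall w, spells X w g -> (len g <= size w)%N).
Proof.
pose P := [set n | (exists2 w, spells X w g & size w = n) /\
                   (forall w, spells X w g -> (n <= size w)%N)].
suff /(xgetPex 0%N) : exists n, P n by [].
have [w0 w0g] := X_gen g.
have ex : exists n, `[< exists2 w, spells X w g & size w = n >].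
  by exists (size w0); apply/asboolP; exists w0.
exists (ex_minn ex); case: ex_minnP => m /asboolP mw mmin; split=> //.
by move=> w wg; apply: mmin; apply/asboolP; exists w.
Qed.

Lemma exists_geodesic_word g : exists w, geodesic_word X w g.
Proof. by have [[w wg sw] _] := word_length_prop g; exists w. Qed.

Lemma word_length_le w g : spells X w g -> (len g <= size w)%N.
Proof. by have [_] := word_length_prop g; apply. Qed.

Lemma word_length1 : len 1%g = 0%N.
Proof.
apply/eqP; rewrite -leqn0; apply: (@word_length_le [::]).
by split=> //; rewrite word_value_nil.
Qed.

Lemma word_lengthM g h : (len (g * h)%g <= len g + len h)%N.
Proof.
have [w [wg <-]] := exists_geodesic_word g.
have [v [vh <-]] := exists_geodesic_word h.
by rewrite -size_cat; apply: word_length_le; exact: spells_cat.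
Qed.

Lemma word_length_gen x : X x \/ x = 1%g -> (len x <= 1)%N.
Proof.
case=> [Xx|->]; last by rewrite word_length1.
apply: (@word_length_le [:: x]); split; first by move=> z; rewrite inE => /eqP->.
by rewrite word_value_cons word_value_nil mulg1.
Qed.

Lemma word_lengthV g : len (g^-1)%g = len g.
Proof.
have le h : (len (h^-1)%g <= len h)%N.
  have [w [wh <-]] := exists_geodesic_word h.
  by rewrite -[size w](size_map (fun x => x^-1)%g) -size_rev;
     apply: word_length_le; exact: spells_inv.
by apply/eqP; rewrite eqn_leq le -{1}[g]invgK le.
Qed.

Lemma word_distxx g : d g g = 0%N.
Proof. by rewrite /word_dist mulVg word_length1. Qed.

Lemma word_distC g h : d g h = d h g.
Proof. by rewrite /word_dist -word_lengthV invgM invgK. Qed.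

Lemma word_dist_triangle g h k : (d g k <= d g h + d h k)%N.
Proof.
by rewrite /word_dist -[in X in (X <= _)%N](mulVKg h k) mulgA word_lengthM.
Qed.

Lemma word_dist_mull k g h : d (k * g)%g (k * h)%g = d g h.
Proof. by rewrite /word_dist invgM -mulgA mulKg. Qed.

Lemma word_dist1g g : d 1%g g = len g.
Proof. by rewrite /word_dist invg1 mul1g. Qed.

Lemma word_length_expg_le g n : (len (g ^+ n)%g <= n * len g)%N.
Proof.
elim: n => [|n IH]; first by rewrite expg0 word_length1.
by rewrite expgS (leq_trans (word_lengthM _ _)) // mulSn leq_add2l.
Qed.

Lemma word_dist_expg g m n : (m <= n)%N ->
  d (g ^+ m)%g (g ^+ n)%g = len (g ^+ (n - m))%g.
Proof. by move=> mn; rewrite /word_dist -{1}(subnKC mn) expgnDr mulKg. Qed.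

(** A subword of a geodesic word is geodesic: shortening one part would shorten
the whole word. *)
Lemma geodesic_word_cat w1 w2 g : geodesic_word X (w1 ++ w2) g ->
  [/\ len (word_value w1) = size w1, len (word_value w2) = size w2 &
      (word_value w1 * word_value w2)%g = g].
Proof.
move=> [[Xw wg] sw].
have l1 : (len (word_value w1) <= size w1)%N.
  by apply: word_length_le; split=> // z z1; apply: Xw; rewrite mem_cat z1.
have l2 : (len (word_value w2) <= size w2)%N.
  by apply: word_length_le; split=> // z z1; apply: Xw; rewrite mem_cat z1 orbT.
have := word_lengthM (word_value w1) (word_value w2).
by rewrite -word_value_cat wg -sw size_cat; split; [lia|lia|].
Qed.

End WordLength.

(** * Hyperbolicity as a four-point condition *)

(** Up to the factor 2 this is Gromov's inequality for Gromov products, written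
without a base point and without halves, so that it lives in the natural
numbers. *)
Definition four_point (G : groupType) (X : set G) (D : nat) : Prop :=
  forall x y z t : G,
    (word_dist X x z + word_dist X y t <=
     maxn (word_dist X x y + word_dist X z t)
          (word_dist X x t + word_dist X y z) + D)%N.


Section CayleyGeometry.
Variables (R : realType) (G : groupType) (X : set G).
Hypotheses (X_sym : symmetric_set X) (X_gen : generates X).
Implicit Types (g h p q x y : G) (w : seq G) (s t e : R).

Local Notation len := (word_length X).
Local Notation d := (word_dist X).
Local Notation cd := (@cayley_dist R G X).

Let dC := word_distC X_sym X_gen.
Let dT := word_dist_triangle X_gen.
Let dxx := word_distxx X_gen.

Lemma dist_via_vertices_le g h x y s t e :
  dist_via_vertices X (g, x, s) (h, y, t) <= e ->
  [\/ s + (d g h)%:R + t <= e, s + (d g (h * y)%g)%:R + (1 - t) <= e,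
      (1 - s) + (d (g * x)%g h)%:R + t <= e |
      (1 - s) + (d (g * x)%g (h * y)%g)%:R + (1 - t) <= e].
Proof.
rewrite /dist_via_vertices !ge_min => /orP[/orP[]|/orP[]] H.
- exact: Or41. - exact: Or42. - exact: Or43. - exact: Or44.
Qed.

(** Distances from a vertex to a point of the graph can be replaced by distances
to one endpoint of the edge of that point, with no loss in the bound: a shortest
path enters the edge through an endpoint.  Hence everything below can be said
about vertices only. *)
Lemma vertex_near_edge g x h y t e : (X x \/ x = 1%g) -> 0 <= t <= 1 ->
  cd (g, x, 0) (h, y, t) <= e ->
  (d g h)%:R <= e \/ (d g (h * y)%g)%:R <= e.
Proof.
move=> /(word_length_gen X_gen) x1 /andP[t0 t1].
have dgx : (d g (g * x)%g <= 1)%N by rewrite /word_dist mulKg.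
have via : dist_via_vertices X (g, x, 0) (h, y, t) <= e ->
    (d g h)%:R <= e \/ (d g (h * y)%g)%:R <= e.
  have tri1 : (d g h)%:R <= 1 + (d (g * x)%g h)%:R :> R.
    by rewrite -(natrD _ 1) ler_nat; have := dT g (g * x)%g h; lia.
  have tri2 : (d g (h * y)%g)%:R <= 1 + (d (g * x)%g (h * y)%g)%:R :> R.
    by rewrite -(natrD _ 1) ler_nat; have := dT g (g * x)%g (h * y)%g; lia.
  by case/dist_via_vertices_le => ?; [left|right|left|right]; lra.
rewrite /cayley_dist -/(dist_via_vertices X (g, x, 0) (h, y, t)).
case: ifP => [/andP[/eqP hg _]|_].
  rewrite ge_min => /orP[le|]; last exact: via.
  by left; rewrite hg dxx; exact: le_trans (normr_ge0 _) le.
case: ifP => [/and3P[_ /eqP hg /eqP yx]|_]; last exact: via.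
rewrite ge_min => /orP[le|]; last exact: via.
by right; rewrite hg yx mulgK dxx; exact: le_trans (normr_ge0 _) le.
Qed.

Lemma dist_via_verticesC u v : dist_via_vertices X u v = dist_via_vertices X v u :> R.
Proof.
case: u => [[g x] s]; case: v => [[h y] t].
rewrite /dist_via_vertices (dC h) (dC h) (dC (h * y)%g) (dC (h * y)%g).
rewrite -!minA; congr Num.min; first lra.
by rewrite minCA; do ![congr Num.min; first lra]; lra.
Qed.

Lemma cayley_distC u v : cd u v = cd v u.
Proof.
have := dist_via_verticesC u v.
case: u => [[g x] s]; case: v => [[h y] t] via.
rewrite /cayley_dist -!/(dist_via_vertices X _ _) via.
rewrite (eq_sym h) (eq_sym y); case: ifP => _; first by rewrite distrC.
have -> : [&& x != 1%g, h == (g * x)%g & y == (x^-1)%g] =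
          [&& y != 1%g, g == (h * y)%g & x == (y^-1)%g].
  by apply/and3P/and3P => -[n1 /eqP -> /eqP ->];
     rewrite invg_eq1 mulgK invgK; split.
by case: ifP => // _; congr Num.min; congr `| _ |; lra.
Qed.

(** The real parametrization of the path with initial vertex p and label w.  At
the integer time size w the default letter 1 makes it the final vertex. *)
Definition word_point p w s : cayley_point R G :=
  ((p * word_value (take (Num.truncn s) w))%g, nth 1%g w (Num.truncn s),
   s - (Num.truncn s)%:R).

Lemma geodesic_word_dist p w g i j : geodesic_word X w g ->
  (i <= j <= size w)%N ->
  d (p * word_value (take i w))%g (p * word_value (take j w))%g = (j - i)%N.
Proof.
move=> wg /andP[ij js]; rewrite word_dist_mull.
have wE : w = take j w ++ drop j w by rewrite cat_take_drop.
pose u := take (j - i) (drop i w).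
have jE : take j w = take i w ++ u by rewrite -{1}(subnKC ij) takeD.
have su : size u = (j - i)%N by rewrite size_takel // size_drop leq_sub2r.
have uE : word_value (take j w) = (word_value (take i w) * word_value u)%g.
  by rewrite {1}jE word_value_cat.
rewrite uE /word_dist mulKg.
have jg : geodesic_word X (take j w) (word_value (take j w)).
  have := wg; rewrite {1}wE => /(geodesic_word_cat X_gen) [l1 _ _].
  split; last by rewrite l1.
  by have [[Xw _] _] := wg; split=> // z /mem_take; exact: Xw.
have := jg; rewrite {1}jE => /(geodesic_word_cat X_gen) [_ -> _].
exact: su.
Qed.

Lemma geodesic_word_nth w g i : geodesic_word X w g ->
  X (nth 1%g w i) \/ nth 1%g w i = 1%g.
Proof.
move=> [[Xw _] _]; have [iw|iw] := ltnP i (size w); last first.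
  by right; rewrite nth_default.
by left; apply: Xw; exact: mem_nth.
Qed.

Lemma word_value_takeS w i :
  (word_value (take i w) * nth 1%g w i = word_value (take i.+1 w))%g.
Proof.
have [iw|iw] := ltnP i (size w).
  by rewrite (take_nth 1%g) // -cats1 word_value_cat word_value_cons word_value_nil mulg1.
by rewrite nth_default // mulg1 !take_oversize // ltnW.
Qed.

Lemma dist_via_vertices_ge g x s h y t e :
  [/\ e <= s + (d g h)%:R + t, e <= s + (d g (h * y)%g)%:R + (1 - t),
      e <= (1 - s) + (d (g * x)%g h)%:R + t &
      e <= (1 - s) + (d (g * x)%g (h * y)%g)%:R + (1 - t)] ->
  e <= dist_via_vertices X (g, x, s) (h, y, t).
Proof.
by case=> ????; rewrite /dist_via_vertices !le_min; apply/andP; split; apply/andP.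
Qed.

(** Among the four routes between the two edges, the one that leaves the first
edge at its end and enters the second one at its start realizes the distance,
since the vertices of a geodesic word are as far apart as their indices. *)
Lemma cayley_dist_word_point p w g s t : geodesic_word X w g ->
  0 <= s -> s <= t -> t <= (size w)%:R ->
  cd (word_point p w s) (word_point p w t) = t - s.
Proof.
move=> wg s0 st tl; rewrite /word_point.
have t0 : 0 <= t by exact: le_trans st.
have /andP[i1 i2] := truncn_itv s0; have /andP[j1 j2] := truncn_itv t0.
set i := Num.truncn s in i1 i2 *; set j := Num.truncn t in j1 j2 *.
have ij : (i <= j)%N by exact: le_truncn.
have jl : (j <= size w)%N by rewrite -(ler_nat R) (le_trans j1).
set v := fun n => (p * word_value (take n w))%g.
have vS n : (v n * nth 1%g w n = v n.+1)%g by rewrite /v -word_value_takeS mulgA.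
have dv m n : (m <= n <= size w)%N -> d (v m) (v n) = (n - m)%N.
  by move=> mn; apply: geodesic_word_dist wg _.
have vbig n : (size w <= n)%N -> v n.+1 = v n.
  by move=> wn; rewrite /v !take_oversize // ltnW.
have jt : (j = size w) -> t = j%:R by move=> e; apply/eqP; rewrite eq_le j1 andbT e.
rewrite -/(v i) -/(v j); rewrite -natr1 in i2; rewrite -natr1 in j2.
have dvR m n : (m <= n <= size w)%N -> (d (v m) (v n))%:R = n%:R - m%:R :> R.
  by move=> mn; rewrite dv // natrB //; case/andP: mn.
(* On a common edge the direct route wins; a detour has to use the endpoints. *)
have [eij|neij] := eqVneq i j.
  rewrite eij /cayley_dist !eqxx /= -/(dist_via_vertices X (_, _, _) (_, _, _)).
  rewrite (_ : s - j%:R - (t - j%:R) = - (t - s)); last lra.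
  rewrite normrN ger0_norm ?subr_ge0 //; apply/min_idPl.
  rewrite eij in i1 i2; apply: dist_via_vertices_ge.
  rewrite !vS (dC (v j.+1) (v j)) !dxx.
  have [e|jw] := eqVneq j (size w).
    have tE := jt e; have vj : v j.+1 = v j by apply: vbig; rewrite e.
    by rewrite vj dxx; split; lra.
  have jw' : (j < size w)%N by rewrite ltn_neqAle jw.
  by rewrite dvR ?leqnSn // -natr1; split; lra.
have ltij : (i < j)%N by rewrite ltn_neqAle neij.
have iw : (i < size w)%N by exact: leq_trans ltij jl.
have A1 := dvR i j; have A3 := dvR i.+1 j; rewrite -natr1 in A3.
rewrite /cayley_dist -/(dist_via_vertices X (_, _, _) (_, _, _)).
have vij : (v j == v i) = false.
  apply/negP => /eqP e; have := dv i j; rewrite e dxx ij jl => /(_ isT); lia.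
(* The two edges are not inverse to each other, as the path does not backtrack. *)
rewrite vij /= ifF; last first.
  apply/negP => /and3P[n1 /eqP e1 /eqP e2].
  have e3 : v j.+1 = v i by rewrite -vS e2 e1 mulgK.
  have [e|jw] := eqVneq j (size w).
    by move: e3; rewrite vbig ?e // => /eqP; rewrite -e vij.
  have jw' : (j < size w)%N by rewrite ltn_neqAle jw.
  have := dv i j.+1; rewrite e3 dxx jw' leqW // => /(_ isT); lia.
have ijR : i%:R + 1 <= j%:R :> R by rewrite natr1 ler_nat.
apply/eqP; rewrite eq_le; apply/andP; split.
  rewrite /dist_via_vertices !ge_min !vS A3 ?ltij ?jl //.
  by apply/orP; right; apply/orP; left; lra.
apply: dist_via_vertices_ge; rewrite !vS A1 ?ij ?jl // A3 ?ltij ?jl //.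
have [e|jw] := eqVneq j (size w).
  have tE := jt e; have vj : v j.+1 = v j by apply: vbig; rewrite e.
  by rewrite vj A1 ?ij ?jl // A3 ?ltij ?jl //; split; lra.
have jw' : (j < size w)%N by rewrite ltn_neqAle jw.
have A2 : (d (v i) (v j.+1))%:R = j%:R + 1 - i%:R :> R.
  by rewrite dvR ?jw' ?(leqW ij) // -natr1.
have A4 : (d (v i.+1) (v j.+1))%:R = j%:R - i%:R :> R.
  by rewrite dvR ?jw' ?(leq_trans ltij) // -!natr1; lra.
by rewrite A2 A4; split; lra.
Qed.

Lemma word_point_graph p w g s : geodesic_word X w g -> 0 <= s <= (size w)%:R ->
  @cayley_graph R G X (word_point p w s).
Proof.
move=> wg /andP[s0 sl]; have /andP[s1 s2] := truncn_itv s0; rewrite -natr1 in s2.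
have [iw|wi] := ltnP (Num.truncn s) (size w).
  left; split=> /=; first by have [[Xw _] _] := wg; apply: Xw; exact: mem_nth.
  by apply/andP; split; lra.
right; rewrite /= nth_default //; split=> //.
by apply/eqP; rewrite subr_eq0 eq_le s1 andbT (le_trans sl) // ler_nat.
Qed.

Lemma geodesic_word_point p q w : geodesic_word X w (p^-1 * q)%g ->
  geodesic_from_to (@cayley_graph R G X) cd (word_point p w) (size w)%:R
    (vertex R p) (vertex R q).
Proof.
move=> wg; split=> //.
- by move=> s; exact: word_point_graph wg.
- move=> s t /andP[s0 sl] /andP[t0 tl]; case: (leP s t) => st.
    by rewrite (cayley_dist_word_point p wg) // ler0_norm ?opprB // subr_le0.
  rewrite cayley_distC (cayley_dist_word_point p wg) ?(ltW st) //.
  by rewrite gtr0_norm // subr_gt0.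
- rewrite /word_point truncn0 take0 word_value_nil mulg1 subr0 /vertex.
  set x := nth _ _ _; rewrite /cayley_dist eqxx /= subr0 normr0.
  have via : 0 <= dist_via_vertices X (p, x, 0 : R) (p, 1%g, 0).
    by apply: dist_via_vertices_ge; rewrite !subr0; split; rewrite !addr_ge0.
  have via0 : dist_via_vertices X (p, x, 0 : R) (p, 1%g, 0) <= 0.
    by rewrite /dist_via_vertices !ge_min dxx !addr0 lexx.
  have {via via0} via : dist_via_vertices X (p, x, 0 : R) (p, 1%g, 0) = 0.
    by apply/eqP; rewrite eq_le via via0.
  rewrite -/(dist_via_vertices X (p, x, 0 : R) (p, 1%g, 0)) via.
  rewrite minxx; case: ifP => // _; case: ifP => // /and3P[x1 /eqP px _].
  by case/negP: x1; apply/eqP; apply: (mulgI p); rewrite -px mulg1.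
- have -> : word_point p w (size w)%:R = vertex R q.
    rewrite /word_point natrK take_size nth_default // subrr.
    by have [[_ ->] _] := wg; rewrite mulVKg.
  rewrite /vertex /cayley_dist !eqxx /= subrr normr0; apply/min_idPl.
  by apply: dist_via_vertices_ge; rewrite !subr0; split; rewrite !addr_ge0.
Qed.

(** Slimness of triangles, restricted to vertices.  A side of the triangle is
remembered only through the equality case of the triangle inequality. *)
Lemma slim_vertices : cayley_hyperbolic R X -> exists D : nat,
  forall p q r w i, geodesic_word X w (p^-1 * q)%g -> (i <= size w)%N ->
  let m := (p * word_value (take i w))%g in
  (exists2 m', (d q m' + d m' r = d q r)%N & (d m m' <= D)%N) \/
  (exists2 m', (d r m' + d m' p = d r p)%N & (d m m' <= D)%N).
Proof.
move=> [e e0 slim]; exists (Num.truncn e) => p q r w i wg iw m.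
have side h k (u : seq G) t : geodesic_word X u (h^-1 * k)%g -> 0 <= t <= (size u)%:R ->
    cd (word_point p w i%:R) (word_point h u t) <= e ->
    exists2 m', (d h m' + d m' k = d h k)%N & (d m m' <= Num.truncn e)%N.
  move=> ug /andP[t0 tl]; rewrite /word_point natrK subrr -/m.
  have /andP[t1 t2] := truncn_itv t0; rewrite -natr1 in t2.
  have dm j : (d h (h * word_value (take j u))%g +
               d (h * word_value (take j u))%g k = d h k)%N.
    have [ju|ju] := leqP j (size u).
      have hE : h = (h * word_value (take 0 u))%g by rewrite take0 word_value_nil mulg1.
      have kE : k = (h * word_value (take (size u) u))%g.
        by rewrite take_size; have [[_ ->] _] := ug; rewrite mulVKg.
      rewrite {1 4}hE {1 2}kE !(geodesic_word_dist h ug) ?ju ?leqnn //; lia.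
    rewrite take_oversize ?(ltnW ju) //; have [[_ ->] _] := ug.
    by rewrite mulVKg dxx addn0.
  move=> /(vertex_near_edge (geodesic_word_nth i wg)) [|le|le].
  - by apply/andP; split; lra.
  - by exists (h * word_value (take (Num.truncn t) u))%g => //; rewrite truncn_ge_nat.
  - exists (h * word_value (take (Num.truncn t).+1 u))%g => //.
    by rewrite truncn_ge_nat // -word_value_takeS mulgA.
have [w2 w2g] := exists_geodesic_word X_gen (q^-1 * r)%g.
have [w3 w3g] := exists_geodesic_word X_gen (r^-1 * p)%g.
have vD g : @cayley_graph R G X (vertex R g) by right.
have i_in : 0 <= (i%:R : R) <= (size w)%:R by rewrite ler0n ler_nat.
have := slim _ _ _ _ _ _ _ _ _ (vD p) (vD q) (vD r)
  (geodesic_word_point wg) (geodesic_word_point w2g) (geodesic_word_point w3g).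
move=> /(_ i%:R i_in) [[t tl le]|[t tl le]].
- by left; exact: side w2g tl le.
- by right; exact: side w3g tl le.
Qed.

(** Some vertex m of [x, z] is close to both [x, y] and [y, z], by discrete
connectedness of [x, z].  It is also close to [x, t] or to [t, z].  In either
case the paths from x to z and from y to t can be rerouted through m along two
opposite sides of the quadrilateral, which bounds the sum of the diagonals. *)
Lemma hyperbolic_four_point : cayley_hyperbolic R X -> exists D, four_point X D.
Proof.
move=> /slim_vertices[D slim]; exists (4 * D + 4)%N => x y z t.
have [w wg] := exists_geodesic_word X_gen (x^-1 * z)%g.
pose v i := (x * word_value (take i w))%g.
have v0 : v 0%N = x by rewrite /v take0 word_value_nil mulg1.
have vl : v (size w) = z.
  by rewrite /v take_size; have [[_ ->] _] := wg; rewrite mulVKg.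
pose near a b i := exists2 m', (d a m' + d m' b = d a b)%N & (d (v i) m' <= D + 1)%N.
have [i iw [[m2 m2E m2D] [m1 m1E m1D]]] :
    exists2 i, (i <= size w)%N & near z y i /\ near y x i.
  have ex : exists i,
      `[< exists2 m', (d z m' + d m' y = d z y)%N & (d (v i) m' <= D)%N >].
    by exists (size w); apply/asboolP; exists z; rewrite ?vl dxx.
  (* The first vertex near [z, y]; its predecessor is near [y, x]. *)
  case: (ex_minnP ex) => i /asboolP[m2 m2E m2D] imin.
  have iw : (i <= size w)%N.
    by apply: imin; apply/asboolP; exists z; rewrite ?vl dxx.
  exists i => //; split; first by exists m2 => //; rewrite addn1 leqW.
  clear m2 m2E m2D; case: i => [|i] in imin iw *.
    by exists x; rewrite ?v0 dxx // addn0.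
  have [[m m'E mD]|[m mE mD]] := slim x z y w i wg (ltnW iw).
    have : (i.+1 <= i)%N by apply: imin; apply/asboolP; exists m.
    by rewrite ltnn.
  exists m => //; have := dT (v i.+1) (v i) m.
  have := geodesic_word_dist x wg (_ : (i <= i.+1 <= size w)%N).
  rewrite leqnSn iw -/(v i) -/(v i.+1) dC => /(_ isT).
  rewrite -/(v i) in mD; lia.
have [[m3 m3E m3D]|[m3 m3E m3D]] := slim x z t w i wg iw; rewrite -/(v i) in m3D.
- have := dT x m1 z; have := dT m1 (v i) m3; have := dT m1 m3 z.
  have := dT y m1 t; have := dT m1 m3 t.
  have := dC x m1; have := dC x y; have := dC m1 (v i); have := dC z m3; lia.
- have := dT x m3 z; have := dT m3 (v i) m2; have := dT m3 m2 z.
  have := dT y m2 t; have := dT m2 m3 t; have := dT m2 (v i) m3.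
  have := dC x m3; have := dC m3 t; have := dC m2 (v i); have := dC m3 (v i).
  have := dC z m2; have := dC m2 y; have := dC x t; have := dC z y; lia.
Qed.

End CayleyGeometry.

(** * Consequences of the four-point condition *)

Section FourPoint.
Variables (G : groupType) (X : set G).
Hypotheses (X_sym : symmetric_set X) (X_gen : generates X).
Variable D : nat.
Hypothesis X_4pt : four_point X D.
Implicit Types (g h : G).

Local Notation len := (word_length X).
Local Notation d := (word_dist X).

Let dC := word_distC X_sym X_gen.
Let dT := word_dist_triangle X_gen.

Lemma four_points x y z t :
  (d x z + d y t <= d x y + d z t + D)%N \/
  (d x z + d y t <= d x t + d y z + D)%N.
Proof. have := X_4pt x y z t; lia. Qed.

(** The hypothesis says that the path 1, g, g^2 hardly backtracks at g.  The
four-point condition for 1, g, g^2, g^n then gives |g^(n+1)| >= |g^n| + gap with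
gap = |g^2| - |g| - D > 0 by induction, and for 1, g^i, g^(i+1), g^(i+j) it shows
that the orbit does not backtrack at g^i either. *)
Lemma expg_superadditive g :
  (len g + 2 * D + 1 <= len (g ^+ 2)%g)%N ->
  forall i j, (len (g ^+ i)%g + len (g ^+ j)%g + len (g ^+ 2)%g <=
               len (g ^+ (i + j))%g + 2 * len g + 2 * D)%N.
Proof.
move=> gap; pose L n := len (g ^+ n)%g.
have dL m n : (m <= n)%N -> d (g ^+ m)%g (g ^+ n)%g = L (n - m)%N.
  exact: word_dist_expg.
have L0 : L 0%N = 0%N by rewrite /L expg0 (word_length1 X_gen).
have L1 : L 1%N = len g by rewrite /L expg1.
have L2 : (L 2 <= 2 * L 1)%N by rewrite L1; exact: word_length_expg_le.
suff: forall i j, (L i + L j + L 2 <= L (i + j)%N + 2 * L 1 + 2 * D)%N.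
  by rewrite L1.
rewrite -/(L 2%N) -L1 in gap.
clearbody L.
have incr n : (L n + L 2 <= L n.+1 + L 1 + D)%N.
  elim: n => [|[|n] IH]; [lia | lia |].
  have := four_points (g ^+ 0)%g (g ^+ 1)%g (g ^+ 2)%g (g ^+ n.+3)%g.
  by rewrite !dL // !subn0 !subSS !subn0; lia.
have nat0S m : m = 0%N \/ exists m', m = m'.+1.
  by case: m => [|m]; [left | right; exists m].
move=> i j; have [->|[i' ->]] := nat0S i.
  by rewrite L0 !add0n; lia.
have [->|[j' ->]] := nat0S j.
  by rewrite L0 !addn0; lia.
move: i' j' => {}i {}j.
have := four_points (g ^+ 0)%g (g ^+ i.+1)%g (g ^+ i.+2)%g (g ^+ (i.+1 + j.+1))%g.
rewrite !dL; try lia.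
rewrite !subn0 addKn (_ : i.+2 - i.+1 = 1)%N; last lia.
rewrite (_ : i.+1 + j.+1 - i.+2 = j)%N; last lia.
have := incr i.+1; have := incr j; lia.
Qed.

Lemma geodesic_point g m : (m <= len g)%N ->
  exists h, d 1%g h = m /\ d h g = (len g - m)%N.
Proof.
move=> mg; have [w wg] := exists_geodesic_word X_gen g.
have := wg; rewrite -{1}(cat_take_drop m w) => /(geodesic_word_cat X_gen)[l1 l2 e].
have sw : size w = len g by have [] := wg.
exists (word_value (take m w)); split.
  by rewrite word_dist1g l1 size_takel // sw.
by rewrite /word_dist -[in X in (_ * X)%g]e mulKg l2 size_drop sw.
Qed.

(** If |g^2| were much smaller than 2 |g|, the midpoint u of [1, g] and its
translate g u would be close to each other, and u would conjugate g to a
shorter element. *)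
Lemma shortest_in_conj_class_square g : shortest_in_conj_class X g ->
  (2 * D + 1 < len g)%N -> (2 * len g <= len (g ^+ 2)%g + 2 * D)%N.
Proof.
move=> gmin gD.
have [|u [du1 du2]] := @geodesic_point g (len g)./2; first lia.
have dgg x y : d (g * x)%g (g * y)%g = d x y by exact: word_dist_mull.
have du : (len g <= d u (g * u)%g)%N.
  by rewrite /word_dist; have := gmin u; rewrite conjgE.
have d1g : d 1%g g = len g by rewrite word_dist1g.
have dgu : d g (g * u)%g = (len g)./2 by rewrite -[X in d X _]mulg1 dgg.
have dgg2 : d g (g ^+ 2)%g = len g by rewrite expg2 -[X in d X _]mulg1 dgg.
have dgu2 : d (g * u)%g (g ^+ 2)%g = (len g - (len g)./2)%N by rewrite expg2 dgg.
have d1g2 : d 1%g (g ^+ 2)%g = len (g ^+ 2)%g by rewrite word_dist1g.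
have := four_points 1%g u g (g * u)%g.
have := four_points 1%g g (g * u)%g (g ^+ 2)%g.
lia.
Qed.

(** Points that are almost on a geodesic from P to Q are determined by their
distance to P, up to a bounded error. *)
Lemma close_of_same_height P Q z w E :
  (d P z + d z Q <= d P Q + E)%N -> (d P w + d w Q <= d P Q + E)%N ->
  (d z w <= (d P z - d P w) + (d P w - d P z) + E + D)%N.
Proof.
move=> ez ew; have := four_points z P w Q.
have := dC z P; have := dC w P; have := dC w Q; lia.
Qed.

End FourPoint.

(** * The stable norm *)

Section StableNorm.
Variables (R : realType) (G : groupType) (X : set G).
Hypotheses (X_sym : symmetric_set X) (X_gen : generates X).
Implicit Types (g h : G) (i K : R).

Local Notation len := (word_length X).
Local Notation sn := (stable_norm R X).

Let quot g := [set ((len (g ^+ n.+1)%g)%:R / n.+1%:R : R) | n in [set: nat]].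

Let quot_lb g : has_lbound (quot g).
Proof. by exists 0 => _ [n _ <-]; rewrite divr_ge0. Qed.

Let quot_le g n : inf (quot g) * n%:R <= (len (g ^+ n)%g)%:R.
Proof.
case: n => [|n]; first by rewrite mulr0.
by rewrite -ler_pdivlMr // ge_inf //; exists n.
Qed.

(** Fekete's lemma for the subadditive sequence |g^n|. *)
Lemma stable_normE g : sn g = inf (quot g).
Proof.
apply: cvg_lim => //; apply/cvgrPdist_le => e e0.
have e20 : 0 < e / 2 by rewrite divr_gt0.
have [_ [m _ <-] mlt] : exists2 x, quot g x & x < inf (quot g) + e / 2.
  by apply: inf_adherent => //; split=> //; exists ((len (g ^+ 1)%g)%:R / 1); exists 0%N.
near=> n.
have n0 : (0 < n)%N by near: n; exact: nbhs_infty_gt.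
rewrite distrC ger0_norm; last by rewrite subr_ge0 ler_pdivlMr ?ltr0n // quot_le.
rewrite lerBlDl ler_pdivrMr ?ltr0n //.
have big : (m.+1 * len g)%:R <= e / 2 * n%:R :> R.
  rewrite mulrC -ler_pdivrMr //.
  by near: n; exact: nbhs_infty_ger.
have q : (len (g ^+ n)%g <= (n %/ m.+1) * len (g ^+ m.+1)%g + m.+1 * len g)%N.
  rewrite {1}(divn_eq n m.+1) expgnDr (leq_trans (word_lengthM X_gen _ _)) //.
  rewrite mulnC expgnA leq_add ?word_length_expg_le //.
  rewrite (leq_trans (word_length_expg_le X_gen _ _)) // leq_mul2r.
  by rewrite ltnW ?orbT // ltn_mod.
have q1 : ((n %/ m.+1) * len (g ^+ m.+1)%g)%:R <= (inf (quot g) + e / 2) * n%:R.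
  rewrite natrM.
  apply: (@le_trans _ _ ((n %/ m.+1)%:R * ((inf (quot g) + e / 2) * m.+1%:R))).
    by rewrite ler_wpM2l // -ler_pdivrMr ?ltr0n // ltW.
  rewrite mulrCA ler_wpM2l //.
    by rewrite (le_trans _ (ltW mlt)) // divr_ge0.
  by rewrite -natrM ler_nat leq_trunc_div.
have {q} q : (len (g ^+ n)%g)%:R <=
  ((n %/ m.+1) * len (g ^+ m.+1)%g)%:R + (m.+1 * len g)%:R :> R.
  by rewrite -natrD ler_nat.
lra.
Unshelve. all: by end_near.
Qed.

Lemma stable_norm_le g n : sn g * n%:R <= (len (g ^+ n)%g)%:R.
Proof. by rewrite stable_normE quot_le. Qed.

(** The additive error disappears after division by n; this is how every lower
bound on a stable norm is obtained. *)
Lemma le_stable_norm g i K :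
  (forall n : nat, i * n%:R <= (len (g ^+ n)%g)%:R + K) -> i <= sn g.
Proof.
move=> growth; rewrite leNgt; apply/negP; rewrite stable_normE => lti.
have [_ [m _ <-] mlt] : exists2 x, quot g x & x < inf (quot g) + (i - inf (quot g)).
  apply: inf_adherent; first by rewrite subr_gt0.
  by split=> //; exists ((len (g ^+ 1)%g)%:R / 1); exists 0%N.
move: mlt; rewrite addrC subrK ltr_pdivrMr ?ltr0n // => mlt.
pose e := i * m.+1%:R - (len (g ^+ m.+1)%g)%:R.
have e0 : 0 < e by rewrite subr_gt0.
pose k := Num.bound (K / e).
have kK : K < k%:R * e by rewrite -ltr_pdivrMr // unstable.ltr_bound.
have := growth (m.+1 * k)%N; rewrite expgnA.
have : (len (g ^+ m.+1 ^+ k)%g)%:R <= k%:R * (len (g ^+ m.+1)%g)%:R :> R.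
  by rewrite -natrM ler_nat word_length_expg_le.
move: kK; rewrite /e natrM; nra.
Qed.

Lemma stable_norm_ge0 g : 0 <= sn g.
Proof. by apply: (@le_stable_norm _ _ 0) => n; rewrite mul0r addr0. Qed.

Lemma stable_norm_expg_le g m : sn (g ^+ m)%g <= sn g * m%:R.
Proof.
case: m => [|m].
  rewrite mulr0 expg0; have := stable_norm_le (1%g : G) 1.
  by rewrite mulr1 expg1 (word_length1 X_gen).
rewrite -ler_pdivrMr ?ltr0n //.
apply: (@le_stable_norm _ _ (sn (g ^+ m.+1)%g + (m.+1 * len g)%:R)) => n.
have := stable_norm_le (g ^+ m.+1)%g (n %/ m.+1).
rewrite -expgnA => le1.
have le2 : (len (g ^+ (m.+1 * (n %/ m.+1))) <= len (g ^+ n) + m.+1 * len g)%N.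
  have e : (g ^+ (m.+1 * (n %/ m.+1)) = g ^+ n * (g ^+ (n %% m.+1))^-1)%g.
    by apply: (mulIg (g ^+ (n %% m.+1))%g); rewrite mulgVK -expgnDr mulnC -divn_eq.
  rewrite e (leq_trans (word_lengthM X_gen _ _)) // leq_add2l.
  rewrite word_lengthV // (leq_trans (word_length_expg_le X_gen _ _)) // leq_mul2r.
  by rewrite ltnW ?orbT // ltn_mod.
have {le2} le2 : (len (g ^+ (m.+1 * (n %/ m.+1)))%g)%:R <=
   (len (g ^+ n)%g)%:R + (m.+1 * len g)%:R :> R by rewrite -natrD ler_nat.
have le3 : n%:R / m.+1%:R <= (n %/ m.+1)%:R + 1 :> R.
  by rewrite ler_pdivrMr ?ltr0n // natr1 -natrM ler_nat ltnW // -ltn_divLR.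
have : sn (g ^+ m.+1)%g * (n%:R / m.+1%:R) <=
       sn (g ^+ m.+1)%g * ((n %/ m.+1)%:R + 1).
  by rewrite ler_wpM2l // stable_norm_ge0.
rewrite mulrDr mulr1 [sn _ / _ * _]mulrAC -[sn _ * _ / _]mulrA => /le_trans; apply.
by rewrite [leRHS]addrCA [leRHS]addrC lerD2r (le_trans le1).
Qed.

Lemma stable_norm_conj g h : sn g <= sn (g ^ h)%g.
Proof.
apply: (@le_stable_norm _ _ (2 * len h)%:R) => n.
rewrite (le_trans (stable_norm_le _ _)) // -natrD ler_nat -conjXg.
have {1}-> : (g ^+ n = h * (g ^+ n ^ h) * h^-1)%g.
  by rewrite conjgE !mulgA mulgV mul1g mulgK.
have := word_lengthM X_gen (h * (g ^+ n ^ h))%g (h^-1)%g.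
have := word_lengthM X_gen h (g ^+ n ^ h)%g.
have := word_lengthV X_sym X_gen h; lia.
Qed.

Lemma loxodromicP g : loxodromic R X g <-> 0 < sn g.
Proof.
split=> [[eta [nu [eta0 nu0 growth]]]|sn0].
  apply: (lt_le_trans eta0); apply: (@le_stable_norm _ _ nu) => n.
  by rewrite -lerBlDr growth.
exists (sn g), 0; split=> // n.
by rewrite subr0 stable_norm_le.
Qed.

Lemma loxodromic_infinite_order g : loxodromic R X g -> infinite_order g.
Proof.
move=> /loxodromicP sn0 n n0 gn1; have := stable_norm_le g n.
by rewrite gn1 (word_length1 X_gen) leNgt mulr_gt0 // ltr0n.
Qed.

End StableNorm.

(** * A uniform lower bound for the stable norms *)

Section UniformAxes.
Variables (R : realType) (G : groupType) (X : set G).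
Hypotheses (X_sym : symmetric_set X) (X_gen : generates X).
Variable D : nat.
Hypothesis X_4pt : four_point X D.
Hypothesis X_acyl : acylindrical R X.
Implicit Types (g h a : G).

Local Notation len := (word_length X).
Local Notation d := (word_dist X).
Local Notation sn := (stable_norm R X).

(** The form in which acylindricity is used: among N + 1 elements that move two
points at distance at least r by at most E, two coincide.  The points are 1 and
g. *)
Lemma acylindrical_pigeonhole (E : nat) : exists r N : nat,
  forall (g : G) (f : nat -> G), (r <= len g)%N ->
    (forall j, (j <= N)%N -> (len (f j) <= E /\ len (g^-1 * f j * g)%g <= E)%N) ->
  exists j1 j2, (j1 < j2 <= N)%N /\ f j1 = f j2.
Proof.
have [r [N [_ _ HN]]] := X_acyl (ler0n R E).
exists (Num.bound r), N => g f rg fE; apply: contrapT => finj.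
have : (`I_N.+1 #<= `I_N)%card; last by rewrite card_le_II ltnn.
have inj : {in `I_N.+1 &, injective f}.
  move=> i j; rewrite !inE /= !ltnS => iN jN eij.
  by case: (ltngtP i j) => // ij; case: finj; [exists i, j|exists j, i];
     rewrite ij ?iN ?jN.
apply: card_le_trans (HN g _); last first.
  by rewrite (le_trans (ltW (unstable.ltr_bound r))) // ler_nat.
rewrite -(card_le_eql (inj_card_eq inj)); apply: subset_card_le => _ [j /= jN <-].
by have [f1 f2] := fE j jN; rewrite !ler_nat.
Qed.

(** By superadditivity |g^n| - c <= sn (g^n), where c is the error term, and
sn (g^n) <= n sn g. *)
Lemma expg_linear_upper g : (len g + 2 * D + 1 <= len (g ^+ 2)%g)%N ->
  forall n, (len (g ^+ n)%g)%:R <=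
            sn g * n%:R + (2 * len g + 2 * D - len (g ^+ 2)%g)%:R.
Proof.
move=> gap n; set c := (2 * len g + 2 * D - len (g ^+ 2)%g)%N.
rewrite -lerBlDr; apply: le_trans (stable_norm_expg_le R X_sym X_gen g n).
apply: (@le_stable_norm R G X X_gen _ _ 0) => j; rewrite addr0 -expgnA.
have : (j * len (g ^+ n)%g <= len (g ^+ (n * j))%g + j * c)%N.
  elim: j => [|j IH] //; rewrite mulnS.
  have := expg_superadditive X_gen X_4pt gap n (n * j)%N.
  by have := word_length_expg_le X_gen g 2; rewrite -/c; lia.
rewrite -(ler_nat R) natrD !natrM; lra.
Qed.

Lemma exists_shortest_conj g : exists h, shortest_in_conj_class X (g ^ h)%g.
Proof.
have ex : exists n, `[< exists h, len (g ^ h)%g = n >].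
  by exists (len (g ^ 1)%g); apply/asboolP; exists 1%g.
case: (ex_minnP ex) => n /asboolP[h hn] nmin.
exists h => k; rewrite hn -conjgM; apply: nmin; apply/asboolP.
by exists (h * k)%g.
Qed.

Lemma stable_norm_conjE g h : sn (g ^ h)%g = sn g.
Proof.
apply/eqP; rewrite eq_le (stable_norm_conj R X_sym X_gen g h) andbT.
by rewrite -{2}(conjgK h g); exact: (stable_norm_conj R X_sym X_gen).
Qed.

Lemma loxodromic_expg_unbounded g (B : nat) : loxodromic R X g ->
  exists n0, forall n, (n0 <= n)%N -> (B <= len (g ^+ n)%g)%N.
Proof.
move=> /(loxodromicP R X_gen) sn0; exists (Num.bound (B%:R / sn g)) => n n0n.
rewrite -(ler_nat R); apply: le_trans (stable_norm_le R X_gen g n).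
rewrite mulrC -ler_pdivrMr // ltW // (lt_le_trans (unstable.ltr_bound _)) //.
by rewrite ler_nat.
Qed.

(** Choose M so large that M sn g dominates D, and conjugate g so that h^M is
shortest in its conjugacy class.  Then the orbit of h^M does not backtrack, and
neither does that of h^m for any large m, since h^m is at distance at most
M |h| from a power of h^M.  So |h^m| <= m sn g + 8 D for all
large m.  For small i, compare 1, h^n, h^(n+i), h^(2n) with n large. *)
Lemma exists_conj_linear_powers g : loxodromic R X g ->
  exists h, forall i, (len ((g ^ h) ^+ i)%g)%:R <= sn g * i%:R + (17 * D)%:R.
Proof.
move=> glox; have sn0 : 0 < sn g by apply/(loxodromicP R X_gen).
pose M := Num.bound ((5 * D + 2)%:R / sn g).
have M0 : (0 < M)%N.
  rewrite -(ltr0n R); apply: le_lt_trans (unstable.ltr_bound _).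
  by rewrite divr_ge0 // ltW.
have [w wmin] := exists_shortest_conj (g ^+ M)%g; exists w.
move: wmin; rewrite conjXg; set h := (g ^ w)%g => hmin.
have tE : sn h = sn g by exact: stable_norm_conjE.
rewrite -tE in sn0 *.
have hlox : loxodromic R X h by apply/(loxodromicP R X_gen).
set t := sn h in sn0 *.
pose L n := len (h ^+ n)%g.
have Lt n : t * n%:R <= (L n)%:R by exact: stable_norm_le.
have LM : (5 * D + 2 <= L M)%N.
  rewrite -(ler_nat R) (le_trans _ (Lt M)) // mulrC -ler_pdivrMr //.
  by rewrite /t tE ltW // unstable.ltr_bound.
have dL m n : (m <= n)%N -> d (h ^+ m)%g (h ^+ n)%g = L (n - m)%N.
  exact: word_dist_expg.
have add n : (2 * L (M * n) <= L (2 * (M * n)) + 4 * D)%N.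
  have sq := shortest_in_conj_class_square X_gen X_4pt hmin.
  have {sq} sq : (2 * L M <= len (h ^+ M ^+ 2)%g + 2 * D)%N.
    by apply: sq; rewrite -/(L M); lia.
  have gap : (len (h ^+ M)%g + 2 * D + 1 <= len (h ^+ M ^+ 2)%g)%N.
    by rewrite -/(L M); lia.
  have : (L (M * n) + L (M * n) + L (M * 2) <= L (M * (n + n)) + 2 * L M + 2 * D)%N.
    by rewrite /L !expgnA; exact: expg_superadditive.
  have -> : (M * (n + n) = 2 * (M * n))%N by lia.
  by rewrite -expgnA -/(L (M * 2)%N) in sq; lia.
have Lmul n : (L n <= n * L 1)%N.
  by rewrite {2}/L expg1; exact: word_length_expg_le.
have growth B : exists n0, forall n, (n0 <= n)%N -> (B <= L n)%N.
  exact: loxodromic_expg_unbounded.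
have [m0 Hm0] : exists m0, forall m, (m0 <= m)%N -> (2 * L m <= L (2 * m) + 6 * D)%N.
  have [n0 Hn0] := growth (M * L 1 + 6 * D + 1)%N.
  exists (M * n0 + M)%N => m mm0.
  pose i := (m %% M)%N; pose p := (M * (m %/ M))%N.
  have mE : m = (p + i)%N by rewrite /p mulnC -divn_eq.
  have iM : (i < M)%N by rewrite ltn_mod.
  have pn0 : (n0 <= p)%N.
    rewrite /p; apply: (@leq_trans (m %/ M)); last by rewrite leq_pmull.
    by rewrite leq_divRL //; nia.
  have Lp := Hn0 p pn0.
  have Li : (L i <= M * L 1)%N.
    by rewrite (leq_trans (Lmul i)) // leq_mul2r ltnW ?orbT.
  have addp := add (m %/ M)%N; rewrite -/p in addp.
  (* With m = p + i and p a multiple of M, the five points -m, -p, 0, p, m of the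
     orbit are shifted by m to keep the exponents natural. *)
  have := four_points X_4pt (h ^+ i)%g (h ^+ m)%g (h ^+ (m + p))%g (h ^+ (2 * m))%g.
  have := four_points X_4pt (h ^+ 0)%g (h ^+ i)%g (h ^+ m)%g (h ^+ (2 * m))%g.
  rewrite !dL; try lia.
  rewrite !subn0 (_ : m - i = p)%N; last lia.
  rewrite (_ : 2 * m - i = p + m)%N; last lia.
  rewrite (_ : 2 * m - m = m)%N; last lia.
  rewrite (_ : m + p - i = 2 * p)%N; last lia.
  rewrite (_ : 2 * m - (m + p) = i)%N; last lia.
  rewrite addKn; lia.
have [m1 Hm1] : exists m1, forall m, (m1 <= m)%N -> (L m)%:R <= t * m%:R + (8 * D)%:R.
  have [n0 Hn0] := growth (8 * D + 1)%N.
  exists (m0 + n0)%N => m mm.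
  have H1 : (2 * L m <= L (2 * m) + 6 * D)%N by apply: Hm0; lia.
  have H2 : (8 * D + 1 <= L m)%N by apply: Hn0; lia.
  have e : len (h ^+ m ^+ 2)%g = L (2 * m)%N by rewrite -expgnA mulnC.
  have gap : (len (h ^+ m)%g + 2 * D + 1 <= len (h ^+ m ^+ 2)%g)%N.
    by rewrite e -/(L m); lia.
  have := expg_linear_upper gap 1; rewrite expg1 mulr1 e -/(L m).
  have := stable_norm_expg_le R X_sym X_gen h m; rewrite -/t.
  have : (2 * L m + 2 * D - L (2 * m)%N)%:R <= (8 * D)%:R :> R.
    by rewrite ler_nat; lia.
  lra.
move=> i; rewrite -/(L i).
pose n := (m1 + i)%N.
have Hn : (L n)%:R <= t * n%:R + (8 * D)%:R by apply: Hm1; rewrite /n; lia.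
have Hni : (L (n + i)%N)%:R <= t * (n + i)%:R + (8 * D)%:R.
  by apply: Hm1; rewrite /n; lia.
have Hnmi : (L (n - i)%N)%:R <= t * (n - i)%:R + (8 * D)%:R.
  by apply: Hm1; rewrite /n; lia.
have H2n := Lt (2 * n)%N.
rewrite natrB in Hnmi; last by rewrite /n; lia.
rewrite natrD in Hni; rewrite natrM in H2n.
have ti : 0 <= t * i%:R by rewrite mulr_ge0 // ltW.
have := four_points X_4pt (h ^+ n)%g (h ^+ 0)%g (h ^+ (n + i))%g (h ^+ (2 * n))%g.
rewrite (word_distC X_sym X_gen (h ^+ n)%g (h ^+ 0)%g).
rewrite !dL; try (rewrite /n; lia).
rewrite !subn0 addKn (_ : 2 * n - n = n)%N; last lia.
rewrite (_ : 2 * n - (n + i) = n - i)%N; last lia.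
by case; rewrite -(ler_nat R) !natrD ?natrM; rewrite !natrM in Hn Hni Hnmi H2n *; lra.
Qed.

(** Otherwise (N + 1) sn g < 1 for the N of acylindricity with bound 17 D + 1, and the
powers h^0, ..., h^N of a conjugate h of g have length at most 17 D + 1.  They
commute with h^n, so they move the far point h^n just as little, and two of them
coincide, although h has infinite order. *)
Lemma stable_norm_bounded_below :
  exists2 i : R, 0 < i & forall g, loxodromic R X g -> i <= sn g.
Proof.
have [r [N HN]] := acylindrical_pigeonhole (17 * D + 1).
exists (N.+1%:R^-1) => [|g glox]; first by rewrite invr_gt0 ltr0n.
rewrite leNgt; apply/negP => small.
have [w hw] := exists_conj_linear_powers glox; set h := (g ^ w)%g in hw.
have hlox : loxodromic R X h.
  apply/(loxodromicP R X_gen); rewrite stable_norm_conjE.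
  exact/(loxodromicP R X_gen).
have [n0 Hn0] := loxodromic_expg_unbounded r hlox.
have [j jN|j1 [j2 [/andP[j12 j2N] e]]] :=
  HN (h ^+ n0)%g (fun j => h ^+ j)%g (Hn0 _ (leqnn _)).
  suff le : (len (h ^+ j)%g <= 17 * D + 1)%N.
    by split=> //; rewrite -mulgA -expgnDr addnC expgnDr mulKg.
  rewrite -(ler_nat R) (le_trans (hw j)) // addrC natrD lerD2l.
  have jN1 : j%:R <= N.+1%:R :> R by rewrite ler_nat ltnW.
  rewrite (@le_trans _ _ (sn g * N.+1%:R)) // ?ler_wpM2l ?stable_norm_ge0 //.
  by rewrite -ler_pdivlMr ?ltr0n // mul1r ltW.
have /(_ (j2 - j1)%N) := loxodromic_infinite_order X_gen hlox.
rewrite subn_gt0 j12 => /(_ isT); apply.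
by rewrite expgnFr ?(ltnW j12) // e mulgV.
Qed.

End UniformAxes.

(** * Uniform quasi-lines *)

Lemma exp2_beats_linear (R : realType) (i : R) (A B : nat) : 0 < i ->
  exists q : nat, (A + B * q)%:R < i * (2 ^ q)%:R.
Proof.
move=> i0; pose p := (Num.bound ((A + 2 * B)%:R / i)).+1.
exists (2 * p)%N.
have lt1 : (A + 2 * B)%:R < i * p%:R.
  rewrite mulrC -ltr_pdivrMr // (lt_trans (unstable.ltr_bound _)) //.
  by rewrite ltr_nat.
have lt2 : (A + B * (2 * p) <= (A + 2 * B) * p)%N by rewrite /p; nia.
have lt3 : (p * p <= 2 ^ (2 * p))%N.
  by rewrite mul2n -addnn expnD leq_mul // ltnW // ltn_expl.
move: lt2 lt3; rewrite -!(ler_nat R) !natrM => lt2 lt3.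
have p0 : 0 < p%:R :> R by rewrite ltr0n.
nra.
Qed.

Section UniformQuasiLines.
Variables (R : realType) (G : groupType) (X : set G).
Hypotheses (X_sym : symmetric_set X) (X_gen : generates X).
Variable D : nat.
Hypothesis X_4pt : four_point X D.
Hypothesis X_acyl : acylindrical R X.
Implicit Types (g h a : G).

Local Notation len := (word_length X).
Local Notation d := (word_dist X).
Local Notation sn := (stable_norm R X).

(** If |a| exceeds a multiple of D, then a itself does not backtrack.  Otherwise
among a, a^2, a^4, ..., a^(2^q) some element does not backtrack: if each squaring
added at most 2 D to the length, then |a^(2^q)| would grow linearly in q, against
the uniform lower bound on stable norms.  The exponent q depends only on D and
on that bound. *)
Lemma shortest_linear_upper : exists K : nat, forall a,
  loxodromic R X a -> shortest_in_conj_class X a ->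
  forall n, (len (a ^+ n)%g)%:R <= sn a * n%:R + K%:R.
Proof.
have [i i0 Hi] := stable_norm_bounded_below X_sym X_gen X_4pt X_acyl.
(* Above 4 D + 1, a shortest element satisfies the hypothesis of
   expg_superadditive. *)
pose K0 := (5 * D + 5)%N.
have [q Hq] := exp2_beats_linear K0 (2 * D) i0.
exists (3 * (2 ^ q * K0) + 4 * D)%N => a alox amin n.
have [aK0|aK0] := leqP (len a) K0; last first.
  have sq := shortest_in_conj_class_square X_gen X_4pt amin.
  have {sq} sq : (2 * len a <= len (a ^+ 2)%g + 2 * D)%N.
    by apply: sq; rewrite /K0 in aK0; lia.
  have gap : (len a + 2 * D + 1 <= len (a ^+ 2)%g)%N by rewrite /K0 in aK0; lia.
  apply: le_trans (expg_linear_upper R X_sym X_gen X_4pt gap n) _.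
  by rewrite lerD2l ler_nat; lia.
pose L n := len (a ^+ n)%g.
have Lmul n' : (L n' <= n' * K0)%N.
  by rewrite (leq_trans (word_length_expg_le X_gen _ _)) // leq_mul2l aK0 orbT.
have [e eq gap] : exists2 e, (e < q)%N & (L (2 ^ e) + 2 * D + 1 <= L (2 ^ e * 2))%N.
  apply: contrapT => nogap.
  have le e : (e <= q)%N -> (L (2 ^ e) <= K0 + 2 * D * e)%N.
    elim: e => [|e IH] eq; first by rewrite expn0 (leq_trans (Lmul 1%N)) //; lia.
    have := IH (ltnW eq); rewrite expnSr.
    have [gap|] := leqP (L (2 ^ e)%N + 2 * D + 1) (L (2 ^ e * 2)%N); last by lia.
    by case: nogap; exists e.
  have := le q (leqnn _); rewrite -(ler_nat R) leNgt => /negP; apply.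
  apply: (lt_le_trans Hq); apply: le_trans (stable_norm_le R X_gen a (2 ^ q)).
  by rewrite ler_wpM2r // Hi.
pose m := (2 ^ e)%N; rewrite -/m in gap.
have m0 : (0 < m)%N by rewrite expn_gt0.
have mq : (m <= 2 ^ q)%N by rewrite leq_exp2l // ltnW.
have gap' : (len (a ^+ m)%g + 2 * D + 1 <= len (a ^+ m ^+ 2)%g)%N.
  by rewrite -expgnA.
pose j := (n %/ m)%N; pose s := (n %% m)%N.
have nE : n = (m * j + s)%N by rewrite mulnC -divn_eq.
have sm : (s < m)%N by rewrite ltn_mod.
have Lm := Lmul m; have Ls := Lmul s.
have le1 := expg_linear_upper R X_sym X_gen X_4pt gap' j.
rewrite -!expgnA -!/(L _) in le1.
have le2 : (L n <= L (m * j)%N + L s)%N.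
  by rewrite /L {1}nE expgnDr word_lengthM.
have le3 : (2 * L m + 2 * D - L (m * 2) + L s <= 3 * (2 ^ q * K0) + 4 * D)%N.
  have := leq_mul mq (leqnn K0); have := leq_mul (ltnW sm) (leqnn K0); lia.
have le4 : sn (a ^+ m)%g * j%:R <= sn a * n%:R.
  apply: (@le_trans _ _ (sn a * m%:R * j%:R)).
    by rewrite ler_wpM2r // stable_norm_expg_le.
  by rewrite -mulrA -natrM ler_wpM2l ?stable_norm_ge0 // ler_nat nE leq_addr.
move: le2 le3; rewrite -!(ler_nat R) !natrD => le2 le3.
by rewrite -/(L n); lra.
Qed.

Lemma shortest_superadditive : exists K : nat, forall a,
  loxodromic R X a -> shortest_in_conj_class X a ->
  forall i j, (len (a ^+ i)%g + len (a ^+ j)%g <= len (a ^+ (i + j))%g + K)%N.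
Proof.
have [K HK] := shortest_linear_upper; exists (2 * K)%N => a alox amin i j.
have Hi := HK a alox amin i; have Hj := HK a alox amin j.
have := stable_norm_le R X_gen a (i + j).
by rewrite -(ler_nat R) !natrD; lra.
Qed.

End UniformQuasiLines.

(** * Two fellow-travelling quasi-lines *)

Section FellowTravelling.
Variables (G : groupType) (X : set G).
Hypotheses (X_sym : symmetric_set X) (X_gen : generates X).
Variable D : nat.
Hypothesis X_4pt : four_point X D.
Implicit Types (P Q z w V : G).

Local Notation len := (word_length X).
Local Notation d := (word_dist X).

Let dC := word_distC X_sym X_gen.
Let dT := word_dist_triangle X_gen.

(** The points z0, s, i, z1 are almost in order on a geodesic, the ends z0, z1
are within r of points w0, w1 almost on a geodesic from P to Q, and s, i are
further than r from the ends.  Then P, s, i, Q are almost in order, with an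
error that does not depend on r: this is where the neighborhood of radius r is
replaced by one of uniform radius. *)
Lemma middle_between P Q w0 w1 z0 s i z1 E e r :
  (d P w0 + d w0 Q <= d P Q + E)%N ->
  (d P w1 + d w1 Q <= d P Q + E)%N ->
  (d P w0 <= d P w1 + E)%N ->
  (d z0 w0 <= r)%N -> (d z1 w1 <= r)%N ->
  (d z0 s + d s i + d i z1 <= d z0 z1 + e)%N ->
  (r + e + 2 * D + 1 <= d z0 s)%N -> (r + e + 2 * D + 1 <= d i z1)%N ->
  (d P s + d s i + d i Q <= d P Q + 4 * E + e + 3 * D)%N.
Proof.
move=> ew0 ew1 w01 zw0 zw1 chain far0 far1.
have := four_points X_4pt z0 w0 z1 s; have := four_points X_4pt w0 i z1 w1.
have := close_of_same_height X_sym X_gen X_4pt ew0 ew1.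
have := dT s i z1; have := dT z0 w0 s; have := dT w0 s i; have := dT i w1 z1.
have := dT P w0 s; have := dT i w1 Q.
have := dC w0 z0; have := dC z1 s; have := dC i w0.
have := dC w1 z1; have := dC z1 i; lia.
Qed.

(** Moving the endpoint P to P' changes its distance to all points far away on
the way to Q by the same amount, up to D. *)
Lemma height_shift P P' Q z E l :
  (d P z + d z Q <= d P Q + E)%N -> (d P P' <= l)%N ->
  (E + 2 * l + D < 2 * d P z)%N ->
  (d P' z + d P Q <= d P z + d P' Q + D)%N /\
  (d P z + d P' Q <= d P' z + d P Q + D)%N.
Proof.
move=> ez PP' far.
have := four_points X_4pt P' P z Q; have := four_points X_4pt P P' z Q.
have := dT P P' z; have := dT P P' Q; have := dC P' P; lia.
Qed.

(** V is the image of i under an almost translation along the line from P to Q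
by p - d P Q.  The distance from an earlier point s changes by that amount. *)
Lemma dist_to_shifted P Q s i V p q E e :
  (d P s + d s i + d i Q <= d P Q + E)%N ->
  (d P V + d P Q <= d P i + p + D)%N -> (d P i + p <= d P V + d P Q + D)%N ->
  (d V Q + d P Q <= d i Q + q + D)%N ->
  (p + q <= 2 * d P Q + e)%N -> (d P Q <= p + d s i)%N ->
  (d s V + d P Q <= d s i + p + (2 * E + e + 4 * D))%N /\
  (d s i + p <= d s V + d P Q + (2 * E + e + 4 * D))%N.
Proof.
move=> chain V1 V2 V3 pq big.
have es : (d P s + d s Q <= d P Q + (E + e + 2 * D))%N by have := dT s i Q; lia.
have eV : (d P V + d V Q <= d P Q + (E + e + 2 * D))%N by have := dT P s i; lia.
have := close_of_same_height X_sym X_gen X_4pt es eV.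
have := dT P s V; have := dT P i Q; have := dT P s i; lia.
Qed.

(** B plays the role of y b y^-1, and P, Q of two points y b^i of its axis, far
away on both sides.  Seen from P and from Q, the element B^-1 shifts all the points
a^i of the middle part by the same amounts d (B P) Q - d P Q and
d P (B Q) - d P Q (shiftP, shiftQ).  Therefore B^-1 a^(i+j), translated back by
a^j, has the same distances as B^-1 a^i to two points a^s and a^t on either
side, up to a uniform error, and the two points are close.  Exchanging P and
Q covers the other relative orientation of the two axes.
Each constant is what the preceding estimates add up to. *)
Lemma translates_almost_commute (a B P Q w0 w1 : G) (l r k i0 n0 e : nat) :
  (forall i j, (len (a ^+ i)%g + len (a ^+ j)%g <= len (a ^+ (i + j))%g + e)%N) ->
  (d P w0 + d w0 Q <= d P Q + 2 * e)%N ->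
  (d P w1 + d w1 Q <= d P Q + 2 * e)%N ->
  (d P w0 <= d P w1 + 2 * e)%N ->
  (d 1%g w0 <= r)%N -> (d (a ^+ k)%g w1 <= r)%N ->
  (forall i, (i0 <= i)%N -> (r + 2 * e + 2 * D + 1 <= len (a ^+ i)%g)%N) ->
  (d P (B * P)%g <= l)%N -> (d Q (B * Q)%g <= l)%N ->
  (forall i, (i <= k)%N -> (10 * e + 5 * D + 2 * l < 2 * d P (a ^+ i)%g)%N) ->
  (forall i, (i <= k)%N -> (10 * e + 5 * D + 2 * l < 2 * d Q (a ^+ i)%g)%N) ->
  (d (B * P)%g Q + d P (B * Q)%g <= 2 * d P Q + e)%N ->
  (forall n, (n0 <= n)%N -> (l <= len (a ^+ n)%g)%N) ->
  forall i j, (i0 + n0 <= i)%N -> (i + j + n0 + i0 <= k)%N ->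
  (d (a ^- j * (B^-1 * a ^+ (i + j)))%g (B^-1 * a ^+ i)%g <= 86 * e + 41 * D)%N.
Proof.
move=> add ew0 ew1 w01 zw0 zw1 far PBP QBQ Pfar Qfar BPQ n0l i j Hs Ht.
pose L n := len (a ^+ n)%g.
have dL m n : (m <= n)%N -> d (a ^+ m)%g (a ^+ n)%g = L (n - m)%N.
  exact: word_dist_expg.
have chain s t : (i0 <= s)%N -> (s <= t)%N -> (t + i0 <= k)%N ->
    (d P (a ^+ s)%g + L (t - s)%N + d (a ^+ t)%g Q <= d P Q + (10 * e + 3 * D))%N.
  move=> s0 st tk.
  have := @middle_between P Q w0 w1 1%g (a ^+ s)%g (a ^+ t)%g (a ^+ k)%g
    (2 * e) (2 * e) r.
  have d0 m : d 1%g (a ^+ m)%g = L m by rewrite word_dist1g.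
  rewrite !d0 !dL; try lia.
  have Lk : (L s + L (t - s)%N + L (k - t)%N <= L k + 2 * e)%N.
    have := add s (t - s)%N; have := add t (k - t)%N.
    by rewrite !subnKC -!/(L _); lia.
  have Ls : (r + 2 * e + 2 * D + 1 <= L s)%N by apply: far.
  have Lt : (r + 2 * e + 2 * D + 1 <= L (k - t)%N)%N by apply: far; lia.
  move=> H; have := H ew0 ew1 w01 zw0 zw1 Lk Ls Lt; lia.
have BV x z : d x (B^-1 * z)%g = d (B * x)%g z.
  by rewrite -(word_dist_mull X B) mulVKg.
have shiftP t : (i0 <= t)%N -> (t + i0 <= k)%N ->
  (d P (B^-1 * a ^+ t)%g + d P Q <= d P (a ^+ t)%g + d (B * P)%g Q + D)%N /\
  (d P (a ^+ t)%g + d (B * P)%g Q <= d P (B^-1 * a ^+ t)%g + d P Q + D)%N.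
  move=> t0 tk; rewrite BV; apply: (@height_shift _ _ _ _ (10 * e + 3 * D) l) => //.
    have := chain t t t0 (leqnn _) tk; rewrite subnn /L expg0 (word_length1 X_gen); lia.
  by have := Pfar t; lia.
have shiftQ t : (i0 <= t)%N -> (t + i0 <= k)%N ->
  (d (B^-1 * a ^+ t)%g Q + d P Q <= d (a ^+ t)%g Q + d P (B * Q)%g + D)%N /\
  (d (a ^+ t)%g Q + d P (B * Q)%g <= d (B^-1 * a ^+ t)%g Q + d P Q + D)%N.
  move=> t0 tk; rewrite (dC _ Q) BV (dC P Q) (dC _ Q) (dC P _).
  apply: (@height_shift _ _ _ _ (10 * e + 3 * D) l) => //.
    have := chain t t t0 (leqnn _) tk; rewrite subnn /L expg0 (word_length1 X_gen).
    have := dC P Q; have := dC P (a ^+ t)%g; have := dC Q (a ^+ t)%g; lia.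
  by have := Qfar t; lia.
pose c := (21 * e + 10 * D)%N.
have estS s t : (i0 <= s)%N -> (s + n0 <= t)%N -> (t + i0 <= k)%N ->
    (d (a ^+ s)%g (B^-1 * a ^+ t)%g + d P Q <= L (t - s)%N + d (B * P)%g Q + c)%N /\
    (L (t - s)%N + d (B * P)%g Q <= d (a ^+ s)%g (B^-1 * a ^+ t)%g + d P Q + c)%N.
  move=> s0 st tk; have st' : (s <= t)%N by lia.
  have [||p1 p2] := shiftP t; try lia.
  have [||q1 q2] := shiftQ t; try lia.
  have := @dist_to_shifted P Q (a ^+ s)%g (a ^+ t)%g (B^-1 * a ^+ t)%g
    (d (B * P)%g Q) (d P (B * Q)%g) (10 * e + 3 * D) e.
  rewrite dL; last lia.
  move=> /(_ (chain s t s0 st' tk) p1 p2 q1 BPQ) H; rewrite /c.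
  have lL : (l <= L (t - s)%N)%N by apply: n0l; lia.
  have tri := dT P (B * P)%g Q; have [] := H; lia.
have estT s t : (i0 <= s)%N -> (s + n0 <= t)%N -> (t + i0 <= k)%N ->
    (d (a ^+ t)%g (B^-1 * a ^+ s)%g + d P Q <= L (t - s)%N + d P (B * Q)%g + c)%N /\
    (L (t - s)%N + d P (B * Q)%g <= d (a ^+ t)%g (B^-1 * a ^+ s)%g + d P Q + c)%N.
  move=> s0 st tk; have st' : (s <= t)%N by lia.
  have [||p1 p2] := shiftP s; try lia.
  have [||q1 q2] := shiftQ s; try lia.
  have := @dist_to_shifted Q P (a ^+ t)%g (a ^+ s)%g (B^-1 * a ^+ s)%g
    (d P (B * Q)%g) (d (B * P)%g Q) (10 * e + 3 * D) e.
  rewrite (dC (a ^+ t)%g (a ^+ s)%g) dL; last lia.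
  have := chain s t s0 st' tk.
  have := dC Q P; have := dC Q (a ^+ t)%g; have := dC (a ^+ s)%g P.
  have := dC Q (a ^+ s)%g; have := dC Q (B^-1 * a ^+ s)%g.
  have := dC P (B^-1 * a ^+ s)%g.
  have lL : (l <= L (t - s)%N)%N by apply: n0l; lia.
  rewrite /c; have := dT P (B * Q)%g Q; have := dC Q (B * Q)%g.
  move=> e1 e2 e3 e4 e5 e6 e7 e8 ch H.
  have [] := H; lia.
(* Reference points before and after the point B^-1 a^i. *)
pose s := i0; pose t := (i + n0)%N.
set U := (a ^- j * _)%g; set V := (B^-1 * a ^+ i)%g.
have dU m : d (a ^+ m)%g U = d (a ^+ (m + j))%g (B^-1 * a ^+ (i + j))%g.
  by rewrite -(word_dist_mull X (a ^+ j)%g) /U mulVKg -expgnDr addnC.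
have [||| s1 s2] := estS s i; try (rewrite /s; lia).
have [||| s3 s4] := estS (s + j)%N (i + j)%N; try (rewrite /s; lia).
have [||| t1 t2] := estT i t; try (rewrite /t; lia).
have [||| t3 t4] := estT (i + j)%N (t + j)%N; try (rewrite /t; lia).
rewrite -!dU in s3 s4 t3 t4.
rewrite subnDr in s3 s4; rewrite subnDr in t3 t4.
have Lst : (L (i - s)%N + L (t - i)%N <= L (t - s)%N + e)%N.
  have := add (i - s)%N (t - i)%N; rewrite -!/(L _).
  by rewrite (_ : i - s + (t - i) = t - s)%N //; rewrite /s /t; lia.
have dst : d (a ^+ s)%g (a ^+ t)%g = L (t - s)%N by rewrite dL // /s /t; lia.
have := @close_of_same_height _ _ X_sym X_gen _ X_4pt
  (a ^+ s)%g (a ^+ t)%g U V (2 * e + 2 * c).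
rewrite dst (dC U) (dC V).
rewrite -/V in s1 s2 t1 t2; rewrite /c in s1 s2 s3 s4 t1 t2 t3 t4 *.
lia.
Qed.

End FellowTravelling.

(** * Common powers *)

Section Commensurability.
Variables (R : realType) (G : groupType) (X : set G).
Hypotheses (X_sym : symmetric_set X) (X_gen : generates X).
Variable D : nat.
Hypothesis X_4pt : four_point X D.
Hypothesis X_acyl : acylindrical R X.
Implicit Types (g h a b c : G).

Local Notation len := (word_length X).
Local Notation d := (word_dist X).
Local Notation sn := (stable_norm R X).

Let dC := word_distC X_sym X_gen.
Let dT := word_dist_triangle X_gen.

(** Turns the uniform lower bound on the stable norms into numbers of periods that
suit all a at once. *)
Lemma uniform_growth (B : nat) : exists n0, forall a, loxodromic R X a ->
  forall n, (n0 <= n)%N -> (B <= len (a ^+ n)%g)%N.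
Proof.
have [i i0 Hi] := stable_norm_bounded_below X_sym X_gen X_4pt X_acyl.
exists (Num.bound (B%:R / i)) => a alox n n0n.
rewrite -(ler_nat R); apply: le_trans (stable_norm_le R X_gen a n).
apply: (@le_trans _ _ (i * n%:R)); last by rewrite ler_wpM2r // Hi.
rewrite mulrC -ler_pdivrMr // ltW // (lt_le_trans (unstable.ltr_bound _)) //.
by rewrite ler_nat.
Qed.

(** The points y b^p u, for u on a geodesic from 1 to b, are the vertices of the
line L(y, b); they lie almost on a geodesic between remote points of that line. *)
Lemma excess_on_line b u y p n e :
  (forall i j, (len (b ^+ i)%g + len (b ^+ j)%g <= len (b ^+ (i + j))%g + e)%N) ->
  (len u + len (u^-1 * b)%g = len b)%N -> (p < n)%N ->
  (d y (y * b ^+ p * u)%g + d (y * b ^+ p * u)%g (y * b ^+ n)%g <=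
   d y (y * b ^+ n)%g + 2 * e)%N.
Proof.
move=> add ub pn.
have -> : d y (y * b ^+ p * u)%g = len (b ^+ p * u)%g.
  by rewrite -{1}[y]mulg1 -mulgA word_dist_mull word_dist1g.
have -> : d y (y * b ^+ n)%g = len (b ^+ n)%g.
  by rewrite -{1}[y]mulg1 word_dist_mull word_dist1g.
have -> : d (y * b ^+ p * u)%g (y * b ^+ n)%g = len (u^-1 * b * b ^+ (n - p.+1))%g.
  have -> : (y * b ^+ n = y * b ^+ p * (b * b ^+ (n - p.+1)))%g.
    by rewrite -mulgA -expgS -expgnDr -subSn // subSS subnKC // ltnW.
  by rewrite word_dist_mull /word_dist mulgA.
apply: leq_trans (leq_add (word_lengthM X_gen _ _) (word_lengthM X_gen _ _)) _.
have := add p 1%N; have := add p.+1 (n - p.+1)%N.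
by rewrite expg1 subnKC // addn1; lia.
Qed.

(** The general case reduces to x = 1 by a translation.  The constants c and W
do not depend on a, b, r, whereas M, which says how far away the ends of the line
of b are, may.  The elements F j = B a^j B^-1 a^-j move both a^m1 and a^(m1+n1)
by a bounded amount, and n1 periods are enough for acylindricity.  W counts the
periods that this takes: n0 + 1 on both sides so that the shift by at most
|b| <= |a| stays in the middle part, N for the translations by a^-j, and n1. *)
Lemma overlap_commute : exists c W : nat, forall a b,
  loxodromic R X a -> loxodromic R X b ->
  shortest_in_conj_class X a -> shortest_in_conj_class X b ->
  (len b <= len a)%N ->
  forall r k i0 : nat, (forall i, (i0 <= i)%N -> (r + c <= len (a ^+ i)%g)%N) ->
  (i0 + i0 + W <= k)%N ->
  exists M : nat, forall (y : G) (p0 p1 : nat) (u0 u1 : G),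
    (M <= p0)%N -> (M <= p1)%N ->
    (len u0 + len (u0^-1 * b)%g = len b)%N ->
    (len u1 + len (u1^-1 * b)%g = len b)%N ->
    (d 1%g (y * b ^+ p0 * u0)%g <= r)%N ->
    (d (a ^+ k)%g (y * b ^+ p1 * u1)%g <= r)%N ->
    exists m : nat, (0 < m)%N /\ commute (a ^+ m)%g (y * b * y^-1)%g.
Proof.
have [e He] := shortest_superadditive X_sym X_gen X_4pt X_acyl.
have [r1 [N pigeon]] := acylindrical_pigeonhole X_acyl (86 * e + 41 * D).
have [n0 Hn0] := uniform_growth e.
have [n1 Hn1] := uniform_growth r1.
exists (2 * e + 2 * D + 1)%N, (2 * n0.+1 + N + n1)%N.
move=> a b alox blox amin bmin ba r k i0 far kW.
have adda := He a alox amin; have addb := He b blox bmin.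
have [M HM] := loxodromic_expg_unbounded X_gen
  (10 * e + 5 * D + 2 * len b + len b + r + k * len a + 1)%N blox.
exists M => y p0 p1 u0 u1 Mp0 Mp1 u0b u1b d0 d1.
have [B BE] : exists B, B = (y * b * y^-1)%g by exists (y * b * y^-1)%g.
have [n nE] : exists n, n = (p0 + p1 + M).+1 by exists (p0 + p1 + M).+1.
pose P := y; pose Q := (y * b ^+ n)%g.
have BP : (B * P = y * b)%g by rewrite BE /P mulgVK.
have BQ : (B * Q = y * b ^+ n.+1)%g by rewrite BE /Q mulgA mulgVK expgS mulgA.
set w0 := (y * b ^+ p0 * u0)%g in d0 *; set w1 := (y * b ^+ p1 * u1)%g in d1 *.
have ew0 : (d P w0 + d w0 Q <= d P Q + 2 * e)%N.
  by apply: excess_on_line => //; lia.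
have ew1 : (d P w1 + d w1 Q <= d P Q + 2 * e)%N.
  by apply: excess_on_line => //; lia.
have dy i j : (i <= j)%N -> d (y * b ^+ i)%g (y * b ^+ j)%g = len (b ^+ (j - i))%g.
  by move=> ij; rewrite word_dist_mull word_dist_expg.
have yE : y = (y * b ^+ 0)%g by rewrite expg0 mulg1.
have dPQ : d P Q = len (b ^+ n)%g by rewrite /P {1}yE dy // subn0.
have dBPQ : d (B * P)%g Q = len (b ^+ n.-1)%g.
  by rewrite BP -{1}(expg1 b) dy ?subn1 // nE.
have dPBQ : d P (B * Q)%g = len (b ^+ n.+1)%g by rewrite BQ /P {1}yE dy // subn0.
have dPBP : (d P (B * P)%g <= len b)%N.
  by rewrite BP /P {1}yE -{2}(expg1 b) dy // expg1.
have dQBQ : (d Q (B * Q)%g <= len b)%N by rewrite BQ dy // subSnn expg1.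
have shift : (d (B * P)%g Q + d P (B * Q)%g <= 2 * d P Q + e)%N.
  rewrite dPQ dBPQ dPBQ; have := addb n.-1 1%N.
  rewrite expg1 addn1 prednK; last by rewrite nE.
  have : (len (b ^+ n.+1)%g <= len (b ^+ n)%g + len b)%N.
    by rewrite expgSr; exact: word_lengthM.
  lia.
have w0y : (d w0 (y * b ^+ p0)%g <= len b)%N.
  by rewrite dC /w0 -{1}[(y * b ^+ p0)%g]mulg1 word_dist_mull word_dist1g; lia.
have ai i : (i <= k)%N -> (d (a ^+ i)%g 1%g <= k * len a)%N.
  move=> ik; rewrite dC word_dist1g (leq_trans (word_length_expg_le X_gen _ _)) //.
  by rewrite leq_mul2r ik orbT.
have farP i : (i <= k)%N -> (10 * e + 5 * D + 2 * len b < 2 * d P (a ^+ i)%g)%N.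
  move=> ik; have := HM p0 Mp0; have := ai i ik.
  have : d P (y * b ^+ p0)%g = len (b ^+ p0)%g by rewrite /P {1}yE dy // subn0.
  have := dT P (a ^+ i)%g (y * b ^+ p0)%g; have := dT (a ^+ i)%g 1%g (y * b ^+ p0)%g.
  have := dT 1%g w0 (y * b ^+ p0)%g; lia.
have farQ i : (i <= k)%N -> (10 * e + 5 * D + 2 * len b < 2 * d Q (a ^+ i)%g)%N.
  move=> ik; have Mn : (M <= n - p0)%N by lia.
  have := HM _ Mn; have := ai i ik.
  have : d Q (y * b ^+ p0)%g = len (b ^+ (n - p0))%g by rewrite dC dy //; lia.
  have := dT Q (a ^+ i)%g (y * b ^+ p0)%g; have := dT (a ^+ i)%g 1%g (y * b ^+ p0)%g.
  have := dT 1%g w0 (y * b ^+ p0)%g; lia.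
have n0l m : (n0.+1 <= m)%N -> (len b <= len (a ^+ m)%g)%N.
  case: m => // m n0m; have := adda 1%N m; have := Hn0 a alox m n0m.
  by rewrite expg1 add1n; lia.
have close i j : (i0 + n0.+1 <= i)%N -> (i + j + n0.+1 + i0 <= k)%N ->
  (d (a ^- j * (B^-1 * a ^+ (i + j)))%g (B^-1 * a ^+ i)%g <= 86 * e + 41 * D)%N.
  have far' i' : (i0 <= i')%N -> (r + 2 * e + 2 * D + 1 <= len (a ^+ i')%g)%N.
    by move=> /far; lia.
  (* The axes of a and B run in the same or in opposite directions. *)
  case: (leqP (d P w0) (d P w1)) => [le01|lt10].
    apply: (@translates_almost_commute _ _ X_sym X_gen _ X_4pt
      a B P Q w0 w1 (len b) r k) => //.
    by lia.
  apply: (@translates_almost_commute _ _ X_sym X_gen _ X_4pt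
    a B Q P w0 w1 (len b) r k) => //.
  - by have := dC Q w0; have := dC w0 P; have := dC Q P; lia.
  - by have := dC Q w1; have := dC w1 P; have := dC Q P; lia.
  - have := dC Q w0; have := dC Q w1; have := dT P w1 Q; have := dT P w0 Q; lia.
  - by have := dC (B * Q)%g P; have := dC Q (B * P)%g; have := dC Q P; lia.
pose m1 := (i0 + n0.+1 + N)%N.
pose F j := (B * a ^+ j * B^-1 * a ^- j)%g.
have closeF m j : (j <= N)%N -> (m1 <= m)%N -> (m + n0.+1 + i0 <= k)%N ->
    (len (a ^- m * F j * a ^+ m)%g <= 86 * e + 41 * D)%N.
  move=> jN m1m mk; have := close (m - j)%N j.
  rewrite subnK; last by rewrite /m1 in m1m; lia.
  suff -> : d (a ^- j * (B^-1 * a ^+ m))%g (B^-1 * a ^+ (m - j))%g =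
            len (a ^- m * F j * a ^+ m)%g by apply; rewrite /m1 in m1m *; lia.
  rewrite /word_dist expgnFr; last by rewrite /m1 in m1m; lia.
  have cm : (a ^+ m * a ^- j = a ^- j * a ^+ m)%g.
    by apply: commuteV; apply: commute_sym; apply: commuteX2.
  by rewrite cm !invgM !invgK /F !mulgA.
have [|j jN|j1 [j2 [/andP[j12 j2N] eF]]] :=
    pigeon (a ^+ n1)%g (fun j => a ^- m1 * F j * a ^+ m1)%g.
- exact: Hn1.
- split; first by apply: closeF => //; rewrite /m1; lia.
  have -> : (a ^- n1 * (a ^- m1 * F j * a ^+ m1) * a ^+ n1 =
             a ^- (m1 + n1) * F j * a ^+ (m1 + n1))%g.
    by rewrite (expgnDr a m1 n1) invgM !mulgA.
  by apply: closeF => //; rewrite /m1; lia.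
exists (j2 - j1)%N; split; first by rewrite subn_gt0.
have {eF} eF : (a ^+ j1 * B^-1 * a ^- j1 = a ^+ j2 * B^-1 * a ^- j2)%g.
  by move/mulIg: eF => /mulgI; rewrite /F -!mulgA => /mulgI.
have eB : (B^-1 * a ^+ (j2 - j1) = a ^+ (j2 - j1) * B^-1)%g.
  apply: (mulgI (a ^+ j1)%g); apply: (mulIg (a ^- j2)%g).
  rewrite !mulgA -expgnDr subnKC ?(ltnW j12) // -eF.
  by rewrite -(mulgA _ (a ^+ (j2 - j1))%g) -{2}(subnKC (ltnW j12)) expgnDr invgM mulVKg.
rewrite -BE -[B]invgK; apply: commuteV; exact: esym.
Qed.

(** Replacing y by y b^-N makes all the exponents that occur natural. *)
Lemma zexpg_shift b (N : nat) (z : int) : (`|z| <= N)%N ->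
  zexpg b z = (b ^- N * b ^+ absz (z + N%:Z)%R)%g.
Proof.
case: z => k kN.
  rewrite (_ : absz (Posz k + N%:Z)%R = (N + k)%N); last lia.
  by rewrite expgnDr mulKg.
rewrite (_ : absz (Negz k + N%:Z)%R = (N - k.+1)%N); last lia.
by rewrite -{1}(subnK kN) expgnDr invgM -mulgA mulVg mulg1.
Qed.

Lemma expg_div_zexpg g (p q : nat) : exists t, zexpg g t = (g ^+ p * g ^- q)%g.
Proof.
have [qp|pq] := leqP q p; first by exists (Posz (p - q)); rewrite /= expgnFr.
exists (Negz (q - p.+1)) => /=; rewrite -subSn // subSS.
by apply: invg_inj; rewrite invgM !invgK expgnFr // ltnW.
Qed.

(** h c^n is almost on a geodesic from 1 to c^(2n): the line through the h c^i is
a translate of the line of <c> and is at finite distance |h| from it, so the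
four-point condition makes this distance uniform for n large.  Hence h c^n is
close to the power c^q with q t nearest to |h c^n|. *)
Lemma centralizer_close (c : G) (t : R) (K : nat) : 0 < t ->
  (forall n, t * n%:R <= (len (c ^+ n)%g)%:R) ->
  (forall n, (len (c ^+ n)%g)%:R <= t * n%:R + K%:R) ->
  exists E : nat, forall h, commute c h ->
    exists p q : nat, (len (c ^- q * (h * c ^+ p))%g <= E)%N.
Proof.
move=> t0 Lge Lle.
exists (3 * K + 3 * D + Num.bound t)%N => h ch.
pose n := Num.bound ((2 * len h + 2 * D + K + 1)%:R / t).
have nt : (2 * len h + 2 * D + K + 1)%:R < t * n%:R.
  by rewrite mulrC -ltr_pdivrMr // unstable.ltr_bound.
pose L n := len (c ^+ n)%g.
have L2 : (2 * len h + 2 * D + K + 1 <= L (2 * n))%N.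
  rewrite -(ler_nat R) (le_trans (ltW nt)) // (le_trans _ (Lge (2 * n)%N)) //.
  by rewrite ler_wpM2l ?(ltW t0) // ler_nat leq_pmull.
have chn m : (h * c ^+ m = c ^+ m * h)%g by apply: commuteX; exact: commute_sym.
(* The distances of h c^n to c^(2n) and to 1. *)
pose f := len (h^-1 * c ^+ n)%g; pose f' := len (h * c ^+ n)%g.
have d1 : d h (h * c ^+ (2 * n))%g = L (2 * n)%N.
  by rewrite -{1}[h]mulg1 word_dist_mull word_dist1g.
have d2 : d (h * c ^+ n)%g (c ^+ (2 * n))%g = f.
  by rewrite mul2n -addnn expgnDr chn word_dist_mull.
have d3 : d h (h * c ^+ n)%g = L n by rewrite -{1}[h]mulg1 word_dist_mull word_dist1g.
have d4 : d (h * c ^+ (2 * n))%g (c ^+ (2 * n))%g = len h.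
  by rewrite chn -[X in d _ X]mulg1 word_dist_mull dC word_dist1g.
have d5 : d (h * c ^+ n)%g (h * c ^+ (2 * n))%g = L n.
  by rewrite word_dist_mull word_dist_expg ?leq_pmull // mul2n -addnn addnK.
have d6 : d 1%g (h * c ^+ n)%g = f' by rewrite word_dist1g.
have d7 : d 1%g (c ^+ (2 * n))%g = L (2 * n)%N by rewrite word_dist1g.
have d8 : d 1%g h = len h by rewrite word_dist1g.
have fL : (L n <= f + len h)%N.
  have := word_lengthM X_gen h (h^-1 * c ^+ n)%g; rewrite mulVKg -/f -/(L n); lia.
have f'L : (L n <= f' + len h)%N.
  have := word_lengthM X_gen (h^-1)%g (h * c ^+ n)%g.
  rewrite mulKg -/f' -/(L n) (word_lengthV X_sym X_gen); lia.
have f'L2 : (f' <= L n + len h)%N.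
  by have := word_lengthM X_gen h (c ^+ n)%g; rewrite -/f' -/(L n); lia.
have ff' : (f + f' <= 2 * L n + 2 * D)%N.
  have := four_points X_4pt h (h * c ^+ n)%g (h * c ^+ (2 * n))%g (c ^+ (2 * n))%g.
  have := four_points X_4pt h 1%g (c ^+ (2 * n))%g (h * c ^+ n)%g.
  have := dC h 1%g; have := dC (c ^+ (2 * n))%g (h * c ^+ n)%g; lia.
pose q := Num.truncn (f'%:R / t).
have /andP[q1 q2] : q%:R <= f'%:R / t < q.+1%:R.
  by apply: truncn_itv; rewrite divr_ge0 // ltW.
rewrite ler_pdivlMr // mulrC in q1; rewrite ltr_pdivrMr // mulrC -natr1 in q2.
have Ln := Lle n; rewrite -/(L n) in Ln.
have q2n : (q <= 2 * n)%N.
  rewrite -(ler_nat R) -(ler_pM2l t0) (le_trans q1) //.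
  move: f'L2 nt; rewrite -(ler_nat R) !natrD !natrM => f'L2 nt.
  have : 0 <= D%:R :> R by []. have : 0 <= (len h)%:R :> R by [].
  lra.
exists n, q; rewrite -/(d (c ^+ q)%g (h * c ^+ n)%g).
have Lq := Lle q; rewrite -/(L q) in Lq.
have L2q := Lle (2 * n - q)%N; rewrite -/(L _) natrB // in L2q.
have L2n := Lge (2 * n)%N; rewrite -/(L _) in L2n.
have tb : t < (Num.bound t)%:R by exact: unstable.ltr_bound.
have dq : d (c ^+ q)%g 1%g = L q by rewrite dC word_dist1g.
have dq2 : d (c ^+ q)%g (c ^+ (2 * n))%g = L (2 * n - q)%N by rewrite word_dist_expg.
rewrite natrM in L2q; rewrite natrM in L2n.
move: ff'; rewrite -(ler_nat R) !natrD => ff'.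
rewrite -(ler_nat R) !natrD.
have D0 : 0 <= D%:R :> R by []. have K0 : 0 <= K%:R :> R by [].
have := four_points X_4pt (c ^+ q)%g 1%g (h * c ^+ n)%g (c ^+ (2 * n))%g.
by rewrite dq dq2 d2 d6 d7; case; rewrite -(ler_nat R) !natrD; lra.
Qed.

(** All h^j are at bounded distance from <c>, so the differences c^-q h^j c^p have
bounded length.  They commute with c, hence move a far power of c by the same
amount, and acylindricity makes two of them equal. *)
Lemma commuting_common_power (c h : G) (t : R) (K : nat) : 0 < t ->
  (forall n, t * n%:R <= (len (c ^+ n)%g)%:R) ->
  (forall n, (len (c ^+ n)%g)%:R <= t * n%:R + K%:R) ->
  commute c h ->
  exists j p q : nat, (0 < j)%N /\ (h ^+ j * c ^+ p = c ^+ q)%g.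
Proof.
move=> t0 Lge Lle ch.
have [E HE] := centralizer_close t0 Lge Lle.
have {HE} [pq Hpq] : exists pq : nat -> nat * nat, forall j,
    (len (c ^- (pq j).2 * (h ^+ j * c ^+ (pq j).1))%g <= E)%N.
  have ex j : exists pq : nat * nat, (len (c ^- pq.2 * (h ^+ j * c ^+ pq.1))%g <= E)%N.
    have /HE[p [q pq]] : commute c (h ^+ j)%g by exact: commuteX.
    by exists (p, q).
  by have [pq] := choice ex; exists pq.
have [r [N pigeon]] := acylindrical_pigeonhole X_acyl E.
pose n := Num.bound (r%:R / t).
have [|j jN|j1 [j2 [/andP[j12 j2N] e]]] :=
  pigeon (c ^+ n)%g (fun j => c ^- (pq j).2 * (h ^+ j * c ^+ (pq j).1))%g.
- rewrite -(ler_nat R) (le_trans _ (Lge n)) // mulrC -ler_pdivrMr //.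
  by rewrite ltW // unstable.ltr_bound.
- split=> //; set g := (c ^- (pq j).2 * _)%g.
  have cg : commute (c ^+ n)%g g.
    apply: commuteM; first exact: commuteV (commuteX2 n _ (commute_refl c)).
    apply: commuteM; first exact: (commuteX2 n j ch).
    exact: (commuteX2 n _ (commute_refl c)).
  by rewrite -mulgA -cg mulKg; exact: Hpq.
exists (j2 - j1)%N, ((pq j2).1 + (pq j1).2)%N, ((pq j1).1 + (pq j2).2)%N.
rewrite subn_gt0 j12; split=> //.
set p1 := (pq j1).1 in e *; set q1 := (pq j1).2 in e *.
set p2 := (pq j2).1 in e *; set q2 := (pq j2).2 in e *.
have cVh q j : (c ^- q * h ^+ j = h ^+ j * c ^- q)%g.
  by apply: commute_sym; apply: commuteV; apply: commute_sym; exact: commuteX2.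
have cc p q : (c ^+ p * c ^- q = c ^- q * c ^+ p)%g.
  by apply: commuteV; exact: commuteX2.
have e' : (c ^+ p1 * c ^- q1 = h ^+ (j2 - j1) * (c ^+ p2 * c ^- q2))%g.
  apply: (mulgI (h ^+ j1)%g); rewrite !cc !mulgA -expgnDr subnKC ?(ltnW j12) //.
  by rewrite -!cVh -!mulgA.
rewrite !expgnDr mulgA; apply: (mulIg (c ^- q1)%g); rewrite mulgK.
apply: (mulIg (c ^- q2)%g).
by rewrite -!mulgA -e'; congr (_ * _)%g; rewrite mulgA cc mulgK.
Qed.

(** Shifting x by a^n and y by b^-N leads to natural exponents.  The shift by a^n
is harmless in the conclusion, because it commutes with the powers of a. *)
Lemma overlap_common_power : exists c W : nat, forall a b,
  loxodromic R X a -> loxodromic R X b ->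
  shortest_in_conj_class X a -> shortest_in_conj_class X b ->
  (len b <= len a)%N ->
  forall r k i0 : nat, (forall i, (i0 <= i)%N -> (r + c <= len (a ^+ i)%g)%N) ->
  (i0 + i0 + W <= k)%N ->
  forall (x y u0 u1 : G) (n n0 n1 : int),
    (len u0 + len (u0^-1 * b)%g = len b)%N ->
    (len u1 + len (u1^-1 * b)%g = len b)%N ->
    (d (x * zexpg a n) (y * zexpg b n0 * u0) <= r)%N ->
    (d (x * zexpg a n * a ^+ k) (y * zexpg b n1 * u1) <= r)%N ->
    exists s t : int, [/\ s <> 0, t <> 0 &
      ((x^-1 * y) * zexpg b s * (y^-1 * x))%g = zexpg a t].
Proof.
have [c [W H]] := overlap_commute.
have [K HK] := shortest_linear_upper X_sym X_gen X_4pt X_acyl.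
exists c, W => a b alox blox amin bmin ba r k i0 far kW x y u0 u1 n n0 n1 u0b u1b d0 d1.
have [M {}H] := H a b alox blox amin bmin ba r k i0 far kW.
pose N := (absz n0 + absz n1 + M)%N.
pose z := (x^-1 * y)%g; pose h := (z * b * z^-1)%g.
set al := zexpg a n in d0 d1 *.
pose y' := (al^-1 * z * b ^- N)%g.
have yE n' u : (absz n' + M <= N)%N ->
    (y * zexpg b n' * u = x * al * (y' * b ^+ absz (n' + N%:Z)%R * u))%g.
  move=> nN; rewrite (@zexpg_shift b N); last lia.
  by rewrite /y' /z !mulgA mulgK mulgV mul1g.
have [m [m0 cm]] : exists m : nat, (0 < m)%N /\ commute (a ^+ m)%g (y' * b * y'^-1)%g.
  apply: (H y' (absz (n0 + N%:Z)%R) (absz (n1 + N%:Z)%R) u0 u1 _ _ u0b u1b).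
  - by rewrite /N; lia.
  - by rewrite /N; lia.
  - move: d0; rewrite yE; last by rewrite /N; lia.
    by rewrite -{1}[(x * al)%g]mulg1 word_dist_mull; apply.
  - move: d1; rewrite yE; last by rewrite /N; lia.
    by rewrite word_dist_mull; apply.
have alm : commute (a ^+ m)%g al.
  rewrite /al; case: (n) => i /=; last apply: commuteV;
    exact: (commuteX2 m _ (commute_refl a)).
have hE : (y' * b * y'^-1 = al^-1 * h * al)%g.
  have bN : (b ^- N * b = b * b ^- N)%g.
    by apply: commute_sym; apply: commuteV; exact: commuteX.
  by rewrite /y' /h -(mulgA _ (b ^- N)%g) bN !invgM !invgK !mulgA mulgVK.
have ch : commute (a ^+ m)%g h.
  have -> : (h = al * (y' * b * y'^-1) * al^-1)%g.
    by rewrite hE !mulgA mulgV mul1g mulgK.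
  by do 2?[apply: commuteM] => //; exact: commuteV.
have t0 : 0 < sn a * m%:R by rewrite mulr_gt0 ?ltr0n //; apply/(loxodromicP R X_gen).
have Lge i : sn a * m%:R * i%:R <= (len ((a ^+ m) ^+ i)%g)%:R.
  by rewrite -mulrA -natrM -expgnA stable_norm_le.
have Lle i : (len ((a ^+ m) ^+ i)%g)%:R <= sn a * m%:R * i%:R + K%:R.
  by rewrite -mulrA -natrM -expgnA HK.
have [j [p [q [j0 jpq]]]] := commuting_common_power t0 Lge Lle ch.
have [t tE] := expg_div_zexpg a (m * q) (m * p).
have hj : (h ^+ j = zexpg a t)%g by rewrite tE !expgnA -jpq mulgK.
have hjE : (h ^+ j = z * b ^+ j * z^-1)%g.
  have -> : h = (b ^ z^-1)%g by rewrite conjgE invgK /h mulgA.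
  by rewrite -conjXg conjgE invgK mulgA.
exists (Posz j), t; split.
- by move=> e; move: j0; have -> : j = 0%N by lia.
- move=> e; apply: (loxodromic_infinite_order X_gen blox j0).
  move: hj; rewrite e hjE /= expg0 => e1.
  by apply: (mulIg z^-1%g); apply: (mulgI z); rewrite mulgA e1 mul1g mulgV.
- by rewrite -hj hjE /z invgM invgK.
Qed.

End Commensurability.

(** * Periodic paths *)

Lemma word_value_nseq (G : groupType) (u : seq G) k :
  word_value (flatten (nseq k u)) = (word_value u ^+ k)%g.
Proof.
elim: k => [|k IH]; first by rewrite word_value_nil expg0.
by rewrite [nseq _ _]/= [flatten _]/= word_value_cat IH expgS.
Qed.

(** Only the vertices x a^(n+i) with i < k are used.  Such a vertex is the start of
the edge labelled by the first letter of the next period. *)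
Lemma vertex_near_line (R : realType) (G : groupType) (X : set G)
    (X_sym : symmetric_set X) (X_gen : generates X)
    (x y a b : G) (r : nat) (u v : seq G) (p : edge_path G) (k i : nat) (n : int) :
  geodesic_word X u a -> geodesic_word X v b -> u <> [::] ->
  subpath (periods x a u n k) p -> (i < k)%N ->
  in_neighborhood X (r%:R : R) (path_points R p) (line_points R y b v) ->
  exists (n' : int) (w : G),
    (word_length X w + word_length X (w^-1 * b)%g = word_length X b)%N /\
    (word_dist X (x * zexpg a n * a ^+ i)%g (y * zexpg b n' * w)%g <= r)%N.
Proof.
move=> ua vb u0 [w1 [w2 [pE xE]]] ik near.
have [Xu uE] := ua.1.
case uu : u u0 => [//|h u'] _.
pose w1' := w1 ++ flatten (nseq i u).
have gE : (p.1 * word_value w1' = x * zexpg a n * a ^+ i)%g.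
  by rewrite /w1' word_value_cat word_value_nseq mulgA -xE uE.
have pE' : exists w2', p.2 = w1' ++ h :: w2'.
  exists (u' ++ flatten (nseq (k - i.+1) u) ++ w2).
  rewrite pE /= /w1' -!catA; congr (_ ++ _).
  rewrite -[in LHS](subnKC ik) addSnnS nseqD flatten_cat /= -!catA; congr (_ ++ _).
  by rewrite {1}uu.
have [w2' pE2] := pE'.
have [z' Lz'] := near ((p.1 * word_value w1')%g, h, 0 : R)
  (or_intror (ex_intro _ w1' (ex_intro _ w2' (ex_intro _ h (ex_intro _ 0
     (And3 pE2 (introT andP (conj (lexx 0) ler01)) erefl)))))).
rewrite gE.
have Xh : X h \/ h = 1%g by left; apply: Xu; rewrite uu mem_head.
case: Lz' => n' [->|[v1 [v2 [e [t [vE t01 ->]]]]]].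
  move=> /(vertex_near_edge X_gen Xh) [|le|le]; first by rewrite lexx ler01.
    by exists n', 1%g; rewrite (word_length1 X_gen) invg1 mul1g mulg1 -(ler_nat R).
  by exists n', 1%g; rewrite (word_length1 X_gen) invg1 mul1g -(ler_nat R).
rewrite /= cats0 in vE.
have pre w w' : v = w ++ w' ->
    (word_length X (word_value w) + word_length X ((word_value w)^-1 * b)%g =
     word_length X b)%N.
  move=> e'; have := vb; rewrite {1}e' => /(geodesic_word_cat X_gen)[l1 l2 bE].
  by rewrite -[in X in (_ * X)%g]bE mulKg l1 l2 -size_cat -e'; case: vb.
move=> /(vertex_near_edge X_gen Xh t01) [le|le].
  by exists n', (word_value v1); split; [exact: pre vE | rewrite -(ler_nat R)].
exists n', (word_value (rcons v1 e)); split.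
  by apply: (pre _ v2); rewrite cat_rcons.
rewrite -cats1 word_value_cat word_value_cons word_value_nil mulg1.
by rewrite -(ler_nat R) mulgA.
Qed.

Theorem theorem1p4 (R : realType) (G : groupType) (X : set G)
    (X_sym : symmetric_set X) (X_gen : generates X)
    (X_hyp : cayley_hyperbolic R X) (X_acyl : acylindrical R X) :
  exists C : R, 0 < C /\
    forall a b : G,
      loxodromic R X a -> loxodromic R X b ->
      shortest_in_conj_class X a -> shortest_in_conj_class X b ->
      (word_length X b <= word_length X a)%N ->
    forall (x y : G) (r : nat) (u v : seq G),
      geodesic_word X u a -> geodesic_word X v b ->
    forall (p : edge_path G) (k : nat),
      subpath_of_line p x a u ->
      contains_periods p x a u k ->
      (2 * r)%:R / injectivity_radius R X + C <= k%:R ->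
      in_neighborhood X r%:R (path_points R p) (line_points R y b v) ->
      (exists s t : int, [/\ s <> 0, t <> 0 &
         ((x^-1 * y) * zexpg b s * (y^-1 * x))%g = zexpg a t]) /\
      commensurable a b.
Proof.
have [D X_4pt] := hyperbolic_four_point X_sym X_gen X_hyp.
have [i i0 Hi] := stable_norm_bounded_below X_sym X_gen X_4pt X_acyl.
have [c [W main]] := overlap_common_power X_sym X_gen X_4pt X_acyl.
(* The term 2 c / i pays for the constant c on both sides, and 3 for two roundings
   and for the last vertex of the last period. *)
exists (2 * (c%:R / i) + W%:R + 3); split.
  by rewrite ltr_wpDl // addr_ge0 // mulr_ge0 // divr_ge0 // ltW.
move=> a b alox blox amin bmin ba x y r u v ua vb p k _ [n pk] kC near.
have ainf := loxodromic_infinite_order X_gen alox.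
have binf := loxodromic_infinite_order X_gen blox.
pose inj := injectivity_radius R X.
have inj_le : inj <= stable_norm R X a.
  by apply: ge_inf; [exists 0 => _ [g _ <-]; exact: stable_norm_ge0 | exists a].
have i_inj : i <= inj.
  by apply: lb_le_inf; [exists (stable_norm R X a), a | move=> _ [g /Hi + <-]].
have inj0 : 0 < inj by exact: lt_le_trans i_inj.
have u0 : u <> [::].
  move=> u0; apply: (ainf 1%N isT).
  by rewrite expg1; have [[_ <-] _] := ua; rewrite u0 word_value_nil.
(* The number of periods to be cut off at each end. *)
pose m := (Num.truncn ((r + c)%:R / inj)).+1.
have q0 : 0 <= (r + c)%:R / inj by rewrite divr_ge0 // ltW.
have far j : (m <= j)%N -> (r + c <= word_length X (a ^+ j)%g)%N.
  move=> mj; rewrite -(ler_nat R); apply: le_trans (stable_norm_le R X_gen a j).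
  apply: (@le_trans _ _ (inj * j%:R)); last by rewrite ler_wpM2r.
  rewrite mulrC -ler_pdivrMr // ltW // (lt_le_trans (truncnS_gt _)) //.
  by rewrite ler_nat.
have mk : (m + m + W <= k.-1)%N.
  have k1 : (m + m + W + 1)%:R <= k%:R :> R.
    apply: le_trans kC; rewrite -/inj /m.
    have /andP[+ _] := truncn_itv q0.
    have : c%:R / inj <= c%:R / i by rewrite ler_wpM2l // lef_pV2.
    by rewrite natrD natrM mulrDl -!natr1 !natrD -!natr1; lra.
  by move: k1; rewrite ler_nat; lia.
have k0 : (0 < k)%N by lia.
have [n0 [w0 [w0b d0]]] := vertex_near_line X_sym X_gen ua vb u0 pk k0 near.
have k1 : (k.-1 < k)%N by lia.
have [n1 [w1 [w1b d1]]] := vertex_near_line X_sym X_gen ua vb u0 pk k1 near.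
rewrite expg0 mulg1 in d0.
have [s [t [s0 t0 st]]] :=
  main a b alox blox amin bmin ba r k.-1 m far mk x y w0 w1 n n0 n1 w0b w1b d0 d1.
split; first by exists s, t.
split=> //; exists (y^-1 * x)%g, t, s; split=> //.
by rewrite invgM invgK st.
Qed.
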